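(* Let $\mathcal{H}$ be the reduced Hamiltonian (truncated by dropping terms of order $\varepsilon^5$ and higher) $$\begin{aligned}\mathcal{H}=\int\Big[&\varepsilon\,\Omega_0|u|^2+\varepsilon^2\frac{g}{2\omega_0}\mathrm{Im}(\overline u\,\partial_Xu)-\varepsilon^3\frac{g^2}{8\omega_0^3}|\partial_Xu|^2+\varepsilon^3\frac{k_0^3(\omega_0-\gamma)(\gamma^2+4\omega_0^2)}{4\omega_0\Omega_0(2\omega_0-\gamma)}|u|^4\\ &-\varepsilon^4\frac{g^3}{16\omega_0^5}\mathrm{Im}(\overline u\,\partial_X^3u)+\varepsilon^4\frac{\beta}{2}|u|^2\mathrm{Im}(\overline u\,\partial_Xu)-\varepsilon^4\frac{k_0^2\omega_0^2}{2\Omega_0^2}|u|^2|D_X||u|^2\Big]dX.\end{aligned}$$ Then the Hamiltonian system $$\partial_t\begin{pmatrix}u\\ \overline u\end{pmatrix}=\varepsilon^{-1}\begin{pmatrix}0&-i\\ i&0\end{pmatrix}\begin{pmatrix}\partial_u\mathcal{H}\\ \partial_{\overline u}\mathcal{H}\end{pmatrix}$$ is the Hamiltonian Dysthe equation $$\begin{aligned}i\,\partial_tu={}&\Omega_0u-i\varepsilon\frac{g}{2\omega_0}\partial_Xu+\varepsilon^2\frac{g^2}{8\omega_0^3}\partial_X^2u+\varepsilon^2\frac{k_0^3(\omega_0-\gamma)(\gamma^2+4\omega_0^2)}{2\omega_0\Omega_0(2\omega_0-\gamma)}|u|^2u\\ &+i\varepsilon^3\frac{g^3}{16\omega_0^5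}\partial_X^3u-i\varepsilon^3\beta|u|^2\partial_Xu-\varepsilon^3\frac{k_0^2\omega_0^2}{\Omega_0^2}\,u\,|D_X||u|^2.\end{aligned}$$
   Context: Fix $g>0$, $\gamma\in\mathbb{R}$ (constant vorticity), $k_0>0$ (carrier wavenumber), $\varepsilon>0$. $u=u(X,t)$ is a complex-valued wave envelope, smooth and decaying in $X\in\mathbb{R}$; $\partial_u,\partial_{\overline u}$ are variational derivatives in the $X$ variable treating $u,\overline u$ as independent; $|D_X|$ is the Fourier multiplier with symbol $|\lambda|$. Let $\omega_0=\sqrt{\gamma^2/4+gk_0}$, $\Omega_0=\frac{\gamma}{2}+\omega_0$, $\omega_{2k_0}=\sqrt{\gamma^2/4+2gk_0}$, $\Omega_{\pm2k_0}=\pm\frac{\gamma}{2}+\omega_{2k_0}$, and $\beta=8\pi\big[c_0^r-\frac12(c_1^r+c_2^r+c_3^{r,1})\big]$ with $$c_0^r=\frac{3k_0^2\Omega_0^2}{16\pi\omega_0^2}-\frac{\gamma gk_0^3\Omega_0}{32\pi\omega_0^4},$$ $$c_1^r=g\,c_1^l\Big(\frac{2\Omega_{2k_0}}{\omega_{2k_0}(2\omega_0^2+\gamma\omega_{2k_0})}-\frac{1}{2\omega_0^2}-\frac{1}{2\omega_{2k_0}^2}+\frac{3}{2gk_0}-\frac{\omega_{2k_0}+\omega_0}{2\omega_{2k_0}\omega_0(2\Omega_0+\Omega_{-2k_0})}\Big),\quad c_1^l=\frac{k_0^3(2\omega_0^2+\gamma\omega_{2k_0})^2}{16\pi\omega_0^2\omega_{2k_0}(2\Omega_0+\Omega_{-2k_0})},$$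 $$c_2^r=g\,c_2^l\Big(\frac{2\Omega_{-2k_0}}{\omega_{2k_0}(2\omega_0^2-\gamma\omega_{2k_0})}-\frac{1}{2\omega_0^2}-\frac{1}{2\omega_{2k_0}^2}+\frac{3}{2gk_0}-\frac{\omega_{2k_0}-\omega_0}{2\omega_{2k_0}\omega_0(2\Omega_0-\Omega_{2k_0})}\Big),\quad c_2^l=-\frac{k_0^3(2\omega_0^2-\gamma\omega_{2k_0})^2}{16\pi\omega_0^2\omega_{2k_0}(2\Omega_0-\Omega_{2k_0})},$$ $$c_3^{r,1}=c_3^l\Big(\frac{1}{k_0}+\frac{g\gamma}{8\Omega_0\omega_0^2}\Big),\quad c_3^l=\frac{\gamma^2k_0^2\omega_0}{2\pi g\Omega_0}.$$ *)

(* Defs.v *)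
From HB Require Import structures.
From mathcomp Require Import all_boot all_order all_algebra.
From mathcomp Require Import all_classical all_reals all_analysis.

Set Implicit Arguments.
Unset Strict Implicit.
Unset Printing Implicit Defensive.

Import Order.TTheory GRing.Theory Num.Theory.
Import numFieldNormedType.Exports.
(* Imported last: Re and Im below are the real-valued projections of R[i]. *)
From mathcomp Require Import complex.

Local Open Scope classical_set_scope.
Local Open Scope ring_scope.
Local Open Scope complex_scope.

(* Calculus of functions R -> R[i].  The type R[i] carries no R-normed module
   structure in the library, so derivatives and integrals are taken
   componentwise. *)

Definition cderivable (R : realType) (f : R -> R[i]) (x : R) : Prop :=
  derivable (fun y => Re (f y)) x 1 /\ derivable (fun y => Im (f y)) x 1.

Definition cderive (R : realType) (f : R -> R[i]) (x : R) : R[i] :=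
  derive1 (fun y => Re (f y)) x +i* derive1 (fun y => Im (f y)) x.

Definition cderiven (R : realType) (n : nat) (f : R -> R[i]) : R -> R[i] :=
  iter n (@cderive R) f.

Definition ccontinuous (R : realType) (f : R -> R[i]) : Prop :=
  continuous (fun x => Re (f x)) /\ continuous (fun x => Im (f x)).

Definition cintegrable (R : realType) (f : R -> R[i]) : Prop :=
  (@lebesgue_measure R).-integrable setT (EFin \o (fun x => Re (f x))) /\
  (@lebesgue_measure R).-integrable setT (EFin \o (fun x => Im (f x))).

Definition cintegral (R : realType) (f : R -> R[i]) : R[i] :=
  Rintegral (@lebesgue_measure R) setT (fun x => Re (f x)) +i*
  Rintegral (@lebesgue_measure R) setT (fun x => Im (f x)).

(* "Smooth and decaying": the Schwartz class. *)
Definition schwartz (R : realType) (f : R -> R[i]) : Prop :=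
  (forall (n : nat) (x : R), cderivable (cderiven n f) x) /\
  (forall m n : nat, exists M : R, forall x : R,
     (`|x| ^+ m)%:C * `|cderiven n f x| <= M%:C).

Definition expi (R : realType) (theta : R) : R[i] := cos theta +i* sin theta.

Definition fourier (R : realType) (f : R -> R[i]) (lambda : R) : R[i] :=
  cintegral (fun x => f x * expi (- (lambda * x))).

Definition fourier_multiplier (R : realType) (m : R -> R) (f : R -> R[i])
    (x : R) : R[i] :=
  ((2 * pi)^-1)%:C *
  cintegral (fun lambda => (m lambda)%:C * fourier f lambda * expi (lambda * x)).

Definition absD (R : realType) : (R -> R[i]) -> R -> R[i] :=
  fourier_multiplier (fun lambda => `|lambda|).

(* [variational_derivatives H u p q]: p and q are the variational derivatives
   of H with respect to u and to its conjugate, regarded as independent: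
     dH(u)[w] = \int (p w + q w^* ) dX   for every admissible variation w.
   Since w and i w are both admissible, the coefficients of w and of w^* are
   determined separately; continuity makes them unique pointwise and not only
   almost everywhere. *)
Definition variational_derivatives (R : realType)
    (H : (R -> R[i]) -> R[i]) (u p q : R -> R[i]) : Prop :=
  [/\ ccontinuous p, ccontinuous q &
   forall w : R -> R[i], schwartz w ->
   let Hw := fun s : R => H (fun X => u X + s%:C * w X) in
   let dH := fun X => p X * w X + q X * (w X)^* in
   [/\ cderivable Hw 0, cintegrable dH & cderive Hw 0 = cintegral dH]].

Definition omega0 (R : realType) (g gamma k0 : R) : R :=
  Num.sqrt (gamma ^+ 2 / 4 + g * k0).

Definition Omega0 (R : realType) (g gamma k0 : R) : R :=
  gamma / 2 + omega0 g gamma k0.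

Definition omega2k0 (R : realType) (g gamma k0 : R) : R :=
  Num.sqrt (gamma ^+ 2 / 4 + 2 * g * k0).

(* Omega_{2 k0} and Omega_{- 2 k0} *)
Definition Omegap2k0 (R : realType) (g gamma k0 : R) : R :=
  gamma / 2 + omega2k0 g gamma k0.

Definition Omegam2k0 (R : realType) (g gamma k0 : R) : R :=
  - (gamma / 2) + omega2k0 g gamma k0.

Definition c0r (R : realType) (g gamma k0 : R) : R :=
  let w0 := omega0 g gamma k0 in
  let W0 := Omega0 g gamma k0 in
  3 * k0 ^+ 2 * W0 ^+ 2 / (16 * pi * w0 ^+ 2)
  - gamma * g * k0 ^+ 3 * W0 / (32 * pi * w0 ^+ 4).

Definition c1l (R : realType) (g gamma k0 : R) : R :=
  let w0 := omega0 g gamma k0 in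
  let W0 := Omega0 g gamma k0 in
  let w2 := omega2k0 g gamma k0 in
  let Wm2 := Omegam2k0 g gamma k0 in
  k0 ^+ 3 * (2 * w0 ^+ 2 + gamma * w2) ^+ 2
  / (16 * pi * w0 ^+ 2 * w2 * (2 * W0 + Wm2)).

Definition c1r (R : realType) (g gamma k0 : R) : R :=
  let w0 := omega0 g gamma k0 in
  let W0 := Omega0 g gamma k0 in
  let w2 := omega2k0 g gamma k0 in
  let Wp2 := Omegap2k0 g gamma k0 in
  let Wm2 := Omegam2k0 g gamma k0 in
  g * c1l g gamma k0 *
  (2 * Wp2 / (w2 * (2 * w0 ^+ 2 + gamma * w2))
   - 1 / (2 * w0 ^+ 2) - 1 / (2 * w2 ^+ 2) + 3 / (2 * g * k0)
   - (w2 + w0) / (2 * w2 * w0 * (2 * W0 + Wm2))).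

Definition c2l (R : realType) (g gamma k0 : R) : R :=
  let w0 := omega0 g gamma k0 in
  let W0 := Omega0 g gamma k0 in
  let w2 := omega2k0 g gamma k0 in
  let Wp2 := Omegap2k0 g gamma k0 in
  - (k0 ^+ 3 * (2 * w0 ^+ 2 - gamma * w2) ^+ 2
     / (16 * pi * w0 ^+ 2 * w2 * (2 * W0 - Wp2))).

Definition c2r (R : realType) (g gamma k0 : R) : R :=
  let w0 := omega0 g gamma k0 in
  let W0 := Omega0 g gamma k0 in
  let w2 := omega2k0 g gamma k0 in
  let Wp2 := Omegap2k0 g gamma k0 in
  let Wm2 := Omegam2k0 g gamma k0 in
  g * c2l g gamma k0 *
  (2 * Wm2 / (w2 * (2 * w0 ^+ 2 - gamma * w2))
   - 1 / (2 * w0 ^+ 2) - 1 / (2 * w2 ^+ 2) + 3 / (2 * g * k0)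
   - (w2 - w0) / (2 * w2 * w0 * (2 * W0 - Wp2))).

Definition c3l (R : realType) (g gamma k0 : R) : R :=
  let w0 := omega0 g gamma k0 in
  let W0 := Omega0 g gamma k0 in
  gamma ^+ 2 * k0 ^+ 2 * w0 / (2 * pi * g * W0).

(* c_3^{r,1} *)
Definition c3r1 (R : realType) (g gamma k0 : R) : R :=
  let w0 := omega0 g gamma k0 in
  let W0 := Omega0 g gamma k0 in
  c3l g gamma k0 * (1 / k0 + g * gamma / (8 * W0 * w0 ^+ 2)).

Definition beta (R : realType) (g gamma k0 : R) : R :=
  8 * pi * (c0r g gamma k0
            - 1 / 2 * (c1r g gamma k0 + c2r g gamma k0 + c3r1 g gamma k0)).

(* `|z| is the R[i]-valued norm.  The functional is R[i]-valued only because
   absD is; its values are real. *)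
Definition hamiltonian (R : realType) (g gamma k0 eps : R)
    (u : R -> R[i]) : R[i] :=
  let w0 := omega0 g gamma k0 in
  let W0 := Omega0 g gamma k0 in
  let b := beta g gamma k0 in
  cintegral (fun X =>
    (eps * W0)%:C * `|u X| ^+ 2
    + (eps ^+ 2 * (g / (2 * w0)))%:C * (Im ((u X)^* * cderive u X))%:C
    - (eps ^+ 3 * (g ^+ 2 / (8 * w0 ^+ 3)))%:C * `|cderive u X| ^+ 2
    + (eps ^+ 3 * (k0 ^+ 3 * (w0 - gamma) * (gamma ^+ 2 + 4 * w0 ^+ 2)
                   / (4 * w0 * W0 * (2 * w0 - gamma))))%:C * `|u X| ^+ 4
    - (eps ^+ 4 * (g ^+ 3 / (16 * w0 ^+ 5)))%:C
      * (Im ((u X)^* * cderiven 3 u X))%:C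
    + (eps ^+ 4 * (b / 2))%:C * `|u X| ^+ 2
      * (Im ((u X)^* * cderive u X))%:C
    - (eps ^+ 4 * (k0 ^+ 2 * w0 ^+ 2 / (2 * W0 ^+ 2)))%:C
      * `|u X| ^+ 2 * absD (fun Y => `|u Y| ^+ 2) X).

(* d_t (u, u^* ) = eps^-1 [0, -i; i, 0] (d_u H, d_{u^*} H) at time t. *)
Definition hamiltonian_system (R : realType) (eps : R)
    (H : (R -> R[i]) -> R[i]) (u : R -> R -> R[i]) (t : R) : Prop :=
  exists p q : R -> R[i],
    variational_derivatives H (fun X => u X t) p q /\
    forall X : R,
      cderive (fun s => u X s) t = (eps^-1)%:C * (- 'i * q X) /\
      cderive (fun s => (u X s)^*) t = (eps^-1)%:C * ('i * p X).

Definition dysthe_equation (R : realType) (g gamma k0 eps : R)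
    (u : R -> R -> R[i]) (t : R) : Prop :=
  let w0 := omega0 g gamma k0 in
  let W0 := Omega0 g gamma k0 in
  let b := beta g gamma k0 in
  let v := fun X => u X t in
  forall X : R,
  'i * cderive (fun s => u X s) t =
    W0%:C * v X
    - 'i * (eps * (g / (2 * w0)))%:C * cderive v X
    + (eps ^+ 2 * (g ^+ 2 / (8 * w0 ^+ 3)))%:C * cderiven 2 v X
    + (eps ^+ 2 * (k0 ^+ 3 * (w0 - gamma) * (gamma ^+ 2 + 4 * w0 ^+ 2)
                   / (2 * w0 * W0 * (2 * w0 - gamma))))%:C
      * `|v X| ^+ 2 * v X
    + 'i * (eps ^+ 3 * (g ^+ 3 / (16 * w0 ^+ 5)))%:C * cderiven 3 v X
    - 'i * (eps ^+ 3 * b)%:C * `|v X| ^+ 2 * cderive v X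
    - (eps ^+ 3 * (k0 ^+ 2 * w0 ^+ 2 / W0 ^+ 2))%:C
      * v X * absD (fun Y => `|v Y| ^+ 2) X.

(* Main.v *)
Require Import Defs.
From mathcomp Require Import all_boot all_order all_algebra.
From mathcomp Require Import all_classical all_reals all_analysis
  measurable_realfun.
From mathcomp Require Import ring lra zify.

(** Writing u = a + i b, everything reduces to real integrals.  Along a Schwartz
    direction the Hamiltonian is a quartic polynomial in the step s, whose
    coefficients are integrals of rapidly decaying functions; its linear
    coefficient is brought to gradient form by exhibiting an explicit
    antiderivative for the local terms, and by the symmetry of |D| for the
    nonlocal one.  For real f, |D| f is built from cosine and sine transforms,
    whose duality (Fubini) gives that symmetry, and whose behaviour under
    differentiation makes |l| times them integrable.  For the converse,
    variational derivatives are unique: two continuous functions with the same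
    integrals against all Gaussians coincide, as narrow Gaussians isolate the
    value at their centre, so no compactly supported test function is needed. *)

Set Implicit Arguments.
Unset Strict Implicit.
Unset Printing Implicit Defensive.

Import Order.TTheory GRing.Theory Num.Theory.
Import numFieldNormedType.Exports.
(* [complex] comes last so that [Re] and [Im] are the projections of [R[i]]. *)
From mathcomp Require Import complex.

Local Open Scope classical_set_scope.
Local Open Scope ring_scope.

(** The symbol [|l|] has a corner at the origin, so |D| f is in general not Schwartz even when f is.
    Hence two classes: [fast], whose members are integrable and stay [fast] when multiplied by
    bounded continuous factors, and [bcont], which is all that is recorded of |D| f. In the energy
    and in its variations |D| f only occurs next to a Schwartz factor, so every integrand remains
    [fast]. The seven coefficients travel as symbols [h1], ..., [h7]. Passing to the gradient
    doubles exactly those of the quartic terms: for |u|^4 by the product rule, for the nonlocal term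
    by the symmetry of |D|, and for the [beta] term because the derivative that integration by parts
    puts on |u|^2 recombines with the variation of |u|^2. This explains the factors 1/2 between the
    Hamiltonian and the equation. Since the energy is real, its two variational derivatives are
    conjugate, and so are the two rows of the system. *)

Notation rint f := (Rintegral (@lebesgue_measure _) setT f).
Notation rintegrable f :=
  ((@lebesgue_measure _).-integrable setT (EFin \o f)).

(** * Rapidly decaying functions and their integrals over the line *)

Section FastDecay.
Variable R : realType.
Implicit Types f g : R -> R.

Definition bcont f := continuous f /\ exists M, forall x, `|f x| <= M.
(** The weight has an integrable reciprocal, which serves as majorant, and it forces limits 0 at
    both ends, which removes boundary terms. *)
Definition fast f :=
  continuous f /\ exists M, forall x, (1 + x ^+ 2) * `|f x| <= M.

Lemma bcont_ext f g : (forall x, f x = g x) -> bcont f -> bcont g.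
Proof. by move=> /funext ->. Qed.

Lemma fast_ext f g : (forall x, f x = g x) -> fast f -> fast g.
Proof. by move=> /funext ->. Qed.

Lemma bcont_cst c : bcont (fun=> c).
Proof.
split; first by move=> x; exact: cvg_cst.
by exists `|c| => x; rewrite lexx.
Qed.

Lemma bcontD f g : bcont f -> bcont g -> bcont (fun x => f x + g x).
Proof.
move=> [cf [M fM]] [cg [N gN]]; split; first by move=> x;
  exact: (cvgD (cf x) (cg x)).
by exists (M + N) => x; apply: le_trans (ler_normD _ _) _; exact: lerD.
Qed.

Lemma bcontM f g : bcont f -> bcont g -> bcont (fun x => f x * g x).
Proof.
move=> [cf [M fM]] [cg [N gN]]; split; first by move=> x;
  exact: (cvgM (cf x) (cg x)).
by exists (M * N) => x; rewrite normrM; exact: ler_pM.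
Qed.

Lemma bcont_cos l : bcont (fun x => cos (l * x)).
Proof.
split; last by exists 1 => x; rewrite ler_norml cos_geN1 cos_le1.
move=> x; apply: (@continuous_comp _ _ _ (fun x : R => l * x) cos).
  exact: mulrl_continuous.
exact: continuous_cos.
Qed.

Lemma bcont_sin l : bcont (fun x => sin (l * x)).
Proof.
split; last by exists 1 => x; rewrite ler_norml sin_geN1 sin_le1.
move=> x; apply: (@continuous_comp _ _ _ (fun x : R => l * x) sin).
  exact: mulrl_continuous.
exact: continuous_sin.
Qed.

Let oneDsqr_gt0 (x : R) : 0 < 1 + x ^+ 2.
Proof. by rewrite ltr_pwDl ?sqr_ge0. Qed.

Lemma fast_bcont f : fast f -> bcont f.
Proof.
move=> [cf [M fM]]; split => //; exists M => x; apply: le_trans (fM x).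
by rewrite ler_peMl// lerDl sqr_ge0.
Qed.

Lemma fastD f g : fast f -> fast g -> fast (fun x => f x + g x).
Proof.
move=> [cf [M fM]] [cg [N gN]]; split; first by move=> x;
  exact: (cvgD (cf x) (cg x)).
exists (M + N) => x; apply: le_trans (lerD (fM x) (gN x)).
by rewrite -mulrDr ler_wpM2l ?ler_normD// ltW.
Qed.

Lemma fastMr f g : fast f -> bcont g -> fast (fun x => f x * g x).
Proof.
move=> [cf [M fM]] [cg [N gN]]; split; first by move=> x;
  exact: (cvgM (cf x) (cg x)).
exists (M * N) => x; rewrite normrM mulrA.
by apply: ler_pM => //; rewrite mulr_ge0// ltW.
Qed.

Lemma fastMl f g : bcont f -> fast g -> fast (fun x => f x * g x).
Proof.
by move=> bf fg; apply: (fast_ext _ (fastMr fg bf)) => x; rewrite mulrC.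
Qed.

Lemma fastZ c f : fast f -> fast (fun x => c * f x).
Proof. exact/fastMl/bcont_cst. Qed.

Lemma fastN f : fast f -> fast (fun x => - f x).
Proof. by move/(fastZ (-1)); apply: fast_ext => x; rewrite mulN1r. Qed.

Lemma fastB f g : fast f -> fast g -> fast (fun x => f x - g x).
Proof. by move=> ff /fastN; exact: fastD. Qed.

(** The integral over the half line is a known finite (arctangent) value; evenness extends it to the
    whole line. *)
Lemma integrable_oneDsqrV : rintegrable (fun x : R => (1 + x ^+ 2)^-1).
Proof.
have mf : measurable_fun setT (fun x : R => (1 + x ^+ 2)^-1).
  by apply: continuous_measurable_fun; exact: continuous_oneDsqrV.
apply/integrableP; split; first exact/measurable_EFinP.
under eq_integral => x _ do rewrite /= gtr0_norm ?invr_gt0//.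
rewrite ge0_symfun_integralT//=.
- rewrite -set_itvcy; have := @integral0y_oneDsqr R; rewrite /oneDsqr /= => ->.
  by rewrite -EFinM ltry.
- by move=> x; rewrite invr_ge0 ltW.
- by move=> x; exact: continuous_oneDsqrV.
- by move=> x /=; rewrite sqrrN.
Qed.

Lemma measurable_fast f : fast f -> measurable_fun setT f.
Proof. by move=> [cf _]; exact: continuous_measurable_fun. Qed.

Lemma integrable_fast f : fast f -> rintegrable f.
Proof.
move=> ff; have mf := measurable_fast ff; case: ff => cf [M fM].
apply: (@le_integrable _ _ _ (@lebesgue_measure R) setT _ _
   (EFin \o (fun x => M * (1 + x ^+ 2)^-1))) => //.
- exact/measurable_EFinP.
- move=> x _ /=; rewrite lee_fin.
  rewrite (le_trans _ (ler_norm _))// ler_pdivlMr// mulrC; exact: fM.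
- exact: (integrableZl measurableT M integrable_oneDsqrV).
Qed.

Lemma rint_ext f g : (forall x, f x = g x) -> rint f = rint g.
Proof. by move=> /funext ->. Qed.

Lemma rintD f g : fast f -> fast g ->
  rint (fun x => f x + g x) = rint f + rint g.
Proof. by move=> ff fg; rewrite RintegralD//; exact: integrable_fast. Qed.

Lemma rintB f g : fast f -> fast g ->
  rint (fun x => f x - g x) = rint f - rint g.
Proof. by move=> ff fg; rewrite RintegralB//; exact: integrable_fast. Qed.

Lemma rintZ c f : fast f -> rint (fun x => c * f x) = c * rint f.
Proof. by move=> ff; rewrite RintegralZl//; exact: integrable_fast. Qed.

Lemma rintN f : fast f -> rint (fun x => - f x) = - rint f.
Proof.
move=> ff; rewrite -mulN1r -rintZ//.
by apply: rint_ext => x; rewrite mulN1r.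
Qed.

Lemma rint0 : rint (fun _ : R => 0 : R) = 0.
Proof. by rewrite Rintegral_cst// mul0r. Qed.

(** A change of variables: the push-forward of Lebesgue measure under [-%R] is Lebesgue measure
    again. *)
Lemma rint_opp f : measurable_fun setT f -> rintegrable (fun x => f (- x)) ->
  rint (fun x => f (- x)) = rint f.
Proof.
move=> mf intf; rewrite /Rintegral; congr fine.
have mopp : measurable_fun setT (-%R : R -> measurableTypeR R).
  by apply: continuous_measurable_fun; exact: opp_continuous.
have mfE : measurable_fun setT (EFin \o f : measurableTypeR R -> \bar R).
  exact/measurable_EFinP.
have := @integral_pushforward _ _ (measurableTypeR R) (measurableTypeR R) R _
  mopp
  (@lebesgue_measure R) setT (EFin \o f) mfE intf measurableT.
rewrite preimage_setT => <-; apply: eq_measure_integral => A mA _.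
exact: lebesgue_measureN.
Qed.

Lemma rint_odd f : fast f -> (forall x, f (- x) = - f x) -> rint f = 0.
Proof.
move=> ff /funext odd.
have := @rint_opp f (measurable_fast ff); rewrite odd.
move=> /(_ (integrable_fast (fastN ff))); rewrite rintN//.
move/eqP; rewrite eq_sym -subr_eq0 opprK.
by rewrite -mulr2n mulrn_eq0 => /eqP.
Qed.

(** Dominated convergence for the truncations of [f], with majorant [|f|]: at each point they are
    eventually constant. This links integrals over the line to the fundamental theorem of calculus
    on segments. *)
Lemma rint_seg_cvg f : rintegrable f ->
  Rintegral (@lebesgue_measure R) `[- n%:R, n%:R] f @[n --> \oo] --> rint f.
Proof.
move=> intf.
have mf : measurable_fun setT f.
  by apply/measurable_EFinP; case/integrableP: intf.
have [] := @dominated_convergence _ _ _ (@lebesgue_measure R) setT measurableT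
  (fun n x => (((f \_ `[- n%:R, n%:R]) x)%:E)) (EFin \o f) (fun x => `|f x|%:E).
- move=> n; apply/measurable_EFinP.
  have [h _] := @measurable_restrictT _ _ _ _ _ f
    (measurable_itv `[- n%:R, n%:R : R]).
  exact: (h (measurable_funS measurableT (@subsetT _ _) mf)).
- exact/measurable_EFinP.
- apply: aeW => x _; apply: cvg_EFin; first exact: nearW.
  apply: cvg_near_cst.
  have [n xn] : exists n : nat, `|x| <= n%:R.
    by exists (Num.truncn `|x|).+1; rewrite ltW// truncnS_gt.
  exists n => // m /= nm; rewrite patchE mem_set//= in_itv/= -ler_norml.
  by rewrite (le_trans xn)// ler_nat.
- exact: integrable_norm.
- apply: aeW => x n _; rewrite lee_fin patchE.
  by case: ifP => //; rewrite normr0.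
move=> _ _; rewrite -(fineK (integrable_fin_num measurableT intf)).
move=> /fine_cvg; rewrite /Rintegral; apply: cvg_trans; apply: near_eq_cvg.
apply: nearW => n /=; congr fine; rewrite [RHS]integral_mkcond.
by apply: eq_integral => x _; rewrite !patchE; case: ifP.
Qed.

(** The single source of integration by parts: on a segment the integral is a difference of boundary
    values of [F], and these tend to 0. *)
Lemma rint_derive0 F f : (forall x : R, is_derive x (1 : R) F (f x)) ->
  fast F ->
  fast f -> rint f = 0.
Proof.
move=> dF [cF [M FM]] ff; have [cf _] := ff.
have M0 : 0 <= M by apply: le_trans (FM 0); rewrite mulr_ge0// ltW.
apply: (@cvg_unique _ _ (Rintegral (@lebesgue_measure R) `[- n%:R,
  n%:R] f @[n --> \oo])).
- exact: Rhausdorff.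
- exact/rint_seg_cvg/integrable_fast.
(* Indexing by [n.+1] keeps the segment nondegenerate. *)
have FTC n : Rintegral (@lebesgue_measure R) `[- n.+1%:R, n.+1%:R] f =
    F n.+1%:R - F (- n.+1%:R).
  rewrite /Rintegral (@continuous_FTC2 _ f F)//.
  - by rewrite gtrN.
  - exact: continuous_subspaceT.
  - split => //.
    + exact/cvg_at_right_filter/cF.
    + exact/cvg_at_left_filter/cF.
  - by move=> x _; rewrite derive1E derive_val.
(* The sign [s] covers both ends at once. As n+1 is at most 1 + (n+1)^2, the boundary value is at
   most M/(n+1). *)
have tail (s : R) : s ^+ 2 = 1 -> F (s * n.+1%:R) @[n --> \oo] --> (0 : R).
  move=> s1; apply: norm_cvg0; apply: (@squeeze_cvgr _ _ _ _ (cst 0) (fun n =>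
    M * n.+1%:R^-1)).
  - apply: nearW => n; rewrite normr_ge0/= ler_pdivlMr// mulrC.
    apply: le_trans (FM (s * n.+1%:R)); rewrite ler_wpM2r// exprMn s1 mul1r.
    by rewrite -natrX -(natrD _ 1) ler_nat; nia.
  - exact: cvg_cst.
  - by rewrite -[X in _ --> X](mulr0 M); apply: cvgMr; exact: cvg_harmonic.
rewrite /= -cvg_shiftS.
suff h : (F n.+1%:R - F (- n.+1%:R)) @[n --> \oo] --> (0 : R).
  apply: cvg_trans h; apply: near_eq_cvg; apply: nearW => n; exact/esym/FTC.
rewrite -[X in _ --> X](subr0 0); apply: cvgB.
  by have := tail 1 (expr1n _ _); under eq_cvg do rewrite mul1r.
have s1 : (-1 : R) ^+ 2 = 1 by rewrite sqrrN expr1n.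
by have := tail _ s1; under eq_cvg do rewrite mulN1r.
Qed.

End FastDecay.

(** * Cosine and sine transforms with a generic bounded kernel *)

Section Transform.
Variable R : realType.
Implicit Types f g h : R -> R.

(** For [k] equal to [cos] or [sin] this is, up to sign, the real or imaginary part of the Fourier
    transform of a real function. A generic [k] treats both together, and also admits the absolute
    value of a kernel. *)
Definition trans (k : R -> R) f (l : R) := rint (fun x => f x * k (l * x)).

Lemma EFin_rint f : fast f ->
  (\int[lebesgue_measure]_x (f x)%:E)%E = (rint f)%:E.
Proof.
by move=> ff; rewrite fineK//; exact: integrable_fin_num (integrable_fast ff).
Qed.

Variable k : R -> R.
Hypothesis bk : bcont k.

Lemma bcont_dilate l : bcont (fun x => k (l * x)).
Proof.
case: bk => ck [M kM]; split; last by exists M.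
move=> x; apply: (@continuous_comp _ _ _ (fun x : R => l * x) k);
  last exact: ck.
exact: mulrl_continuous.
Qed.

Lemma fast_trans_integrand f l : fast f -> fast (fun x => f x * k (l * x)).
Proof. by move=> ff; apply: fastMr => //; exact: bcont_dilate. Qed.

Lemma transD f g : fast f -> fast g ->
  trans k (fun x => f x + g x) = (fun l => trans k f l + trans k g l).
Proof.
move=> ff fg; apply/funext => l; rewrite /trans -rintD.
- by apply: rint_ext => x; rewrite mulrDl.
- exact: fast_trans_integrand.
- exact: fast_trans_integrand.
Qed.

Lemma transZ c f : fast f ->
  trans k (fun x => c * f x) = (fun l => c * trans k f l).
Proof.
move=> ff; apply/funext => l; rewrite /trans -rintZ.
- by apply: rint_ext => x; rewrite mulrA.
- exact: fast_trans_integrand.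
Qed.

Lemma fast_norm f : fast f -> fast (fun x => `|f x|).
Proof.
move=> [cf [M fM]]; split; last by exists M => x; rewrite normr_id.
by move=> x; apply: cvg_norm; exact: cf.
Qed.

(** If [M] bounds [k], the integrand is at most M|f| uniformly in [l]; this majorant yields both
    continuity under the integral sign and the bound. *)
Lemma bcont_trans f : fast f -> bcont (trans k f).
Proof.
move=> ff; have [ck [M kM]] := bk.
have M0 : 0 <= M by apply: le_trans (kM 0).
have fkM l x : `|f x * k (l * x)| <= M * `|f x|.
  by rewrite normrM mulrC ler_wpM2r.
split.
  move=> l; have lI : l \in (`]l - 1, l + 1[%classic : set R).
    by rewrite inE /= in_itv /= ltrDl ltrBlDr ltrDl ltr01.
  apply: (@continuity_under_integral R _ _ (@lebesgue_measure R)
    (fun l x => f x * k (l * x)) setT measurableT (l - 1) (l + 1) _ _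
    (fun x => M * `|f x|) _ _ l lI).
  - by move=> x _; apply: integrable_fast; exact: fast_trans_integrand.
  - apply: aeW => x _ y _.
    apply: cvgM; first exact: cvg_cst.
    apply: (@continuous_comp _ _ _ (fun y : R => y * x) k); last exact: ck.
    exact: mulrr_continuous.
  - by apply: integrable_fast; apply: fastZ; exact: fast_norm.
  - by move=> y _; apply: aeW => x _.
exists (M * rint (fun x => `|f x|)) => l.
apply: le_trans (le_normr_Rintegral _ _) _ => //.
  by apply: integrable_fast; exact: fast_trans_integrand.
rewrite -rintZ; last exact: fast_norm.
apply: le_Rintegral => //; apply: integrable_fast.
  exact/fast_norm/fast_trans_integrand.
exact/fastZ/fast_norm.
Qed.

End Transform.

(** * Moving a transform from one factor to the other *)

Section Duality.
Variable R : realType.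
Implicit Types f g h : R -> R.

Lemma integral_trans k h c x : bcont k -> fast h ->
  (\int[lebesgue_measure]_y (c * (h y * k (x * y)))%:E)%E =
  (c * trans k h x)%:E.
Proof.
move=> bk fh; rewrite /trans -rintZ; last exact: fast_trans_integrand.
by rewrite EFin_rint//; apply: fastZ; exact: fast_trans_integrand.
Qed.

(** Both sides are iterated integrals of g(x) f(y) k(xy), whose kernel is symmetric in x and y. *)
Lemma trans_dual k f g : bcont k -> fast f -> fast g ->
  rint (fun l => g l * trans k f l) = rint (fun x => f x * trans k g x).
Proof.
move=> bk ff fg; have [ck [M kM]] := bk.
pose F (z : R * R) := (g z.1 * (f z.2 * k (z.1 * z.2)))%:E.
have mk : measurable_fun setT k by exact: continuous_measurable_fun.
have mF : measurable_fun setT F.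
  apply/measurable_EFinP; apply: measurable_funM.
    apply: measurableT_comp; first exact: measurable_fast.
    exact: measurable_fst.
  apply: measurable_funM.
    apply: measurableT_comp; first exact: measurable_fast.
    exact: measurable_snd.
  apply: measurableT_comp => //.
  by apply: measurable_funM; [exact: measurable_fst|exact: measurable_snd].
have intF : ((@lebesgue_measure R) \x (@lebesgue_measure R))%E.-integrable setT
  F.
  apply/integrable12ltyP => //.
  have bk' : bcont (fun z => `|k z|).
    split; first by move=> z; apply: cvg_norm; exact: ck.
    by exists M => z; rewrite normr_id.
  (* Tonelli's condition: the inner integral of |F| is |g| times a transform of |f| with kernel |k|,
     which is bounded, so the outer integrand is [fast]. *)
  have E x : (\int[lebesgue_measure]_y `|F (x, y)|)%E =
      (`|g x| * trans (fun z => `|k z|) (fun y => `|f y|) x)%:E.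
    rewrite -integral_trans//; last exact: fast_norm.
    by apply: eq_integral => y _; rewrite /F/= !normrM.
  under eq_integral => x _ do rewrite E.
  rewrite EFin_rint ?ltry//; apply: fastMr; first exact: fast_norm.
  exact/bcont_trans/fast_norm.
have := Fubini intF; rewrite /F /=.
under eq_integral do rewrite integral_trans//.
under [X in _ = X -> _]eq_integral => y _.
  under eq_integral => x _ do rewrite mulrCA [x * y]mulrC.
  rewrite integral_trans//.
  over.
by move=> h; rewrite /Rintegral h.
Qed.

End Duality.

(** * The real Schwartz class: closure properties and Gaussians *)

Section RealSchwartz.
Variable R : realType.
Implicit Types f g h : R -> R.

Lemma is_derive_pM f g (x df dg : R) : is_derive x 1 f df ->
  is_derive x 1 g dg ->
  is_derive x 1 (fun y => f y * g y) (df * g x + f x * dg).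
Proof.
move=> ? ?; have -> : df * g x + f x * dg = f x *: dg + g x *: df.
  by rewrite addrC /GRing.scale /= [df * _]mulrC.
exact: (@is_deriveM _ _ f g).
Qed.

Lemma is_derive_pD f g (x df dg : R) : is_derive x 1 f df ->
  is_derive x 1 g dg ->
  is_derive x 1 (fun y => f y + g y) (df + dg).
Proof. by move=> ? ?; exact: (@is_deriveD _ _ _ f g). Qed.

Lemma is_derive_pZ f (c x df : R) : is_derive x 1 f df ->
  is_derive x 1 (fun y => c * f y) (c * df).
Proof. by move=> ?; exact: (@is_deriveZ _ _ _ f c). Qed.

Lemma is_derive_derive1 f (x : R) : derivable f x 1 ->
  is_derive x 1 f (derive1 f x).
Proof. by move=> df; rewrite derive1E; exact: DeriveDef. Qed.

Lemma derive1_is_derive f f' : (forall x : R, is_derive x (1 : R) f (f' x)) ->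
  derive1 f = f'.
Proof. by move=> df; apply/funext => x; rewrite derive1E;
  exact: derive_val. Qed.

Lemma is_derive_sin_mul (l x : R) :
  is_derive x 1 (fun y : R => sin (l * y)) (l * cos (l * x)).
Proof.
have dl : is_derive x 1 (fun y : R => l * y) l.
  by rewrite -[X in is_derive _ _ _ X](mulr1 l); exact: is_derive_pZ.
by rewrite mulrC; exact: (@is_derive1_comp _ sin (fun y : R => l * y)).
Qed.

Lemma is_derive_cos_mul (l x : R) :
  is_derive x 1 (fun y : R => cos (l * y)) (- l * sin (l * x)).
Proof.
have dl : is_derive x 1 (fun y : R => l * y) l.
  by rewrite -[X in is_derive _ _ _ X](mulr1 l); exact: is_derive_pZ.
have -> : - l * sin (l * x) = - sin (l * x) * l by rewrite !mulNr mulrC.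
exact: (@is_derive1_comp _ cos (fun y : R => l * y)).
Qed.

Definition decay f := forall m, exists M, forall x, `|x| ^+ m * `|f x| <= M.

Definition rschwartz f :=
  (forall n (x : R), derivable (derive1n n f) x (1 : R)) /\ (forall n,
    decay (derive1n n f)).

(** The class constrains all iterated derivatives at once. A family stable under [derive1] reduces
    this to differentiability and decay of its members; products and Gaussians are both handled
    through such a family. *)
Lemma rschwartz_coind (P : (R -> R) -> Prop) :
  (forall f, P f ->
     [/\ forall x : R, derivable f x (1 : R), decay f & P (derive1 f)]) ->
  forall f, P f -> rschwartz f.
Proof.
move=> HP f Pf; have Pn n : P (derive1n n f).
  by elim: n => [|n /HP[]]; rewrite ?derive1nS.
by split => n; have [] := HP _ (Pn n).
Qed.

Lemma rschwartz_derive1 f : rschwartz f -> rschwartz (derive1 f).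
Proof.
by move=> [df Mf]; split => n; have := derive1Sn f n => <-;
  [exact: df|exact: Mf].
Qed.

Lemma rschwartz_derive1n n f : rschwartz f -> rschwartz (derive1n n f).
Proof. by move=> rf; elim: n => // n ?; rewrite derive1nS;
  exact: rschwartz_derive1. Qed.

Lemma rschwartz_derivable f x : rschwartz f -> derivable f x 1.
Proof. by move=> [/(_ 0)]. Qed.

Lemma rschwartz_decay f : rschwartz f -> decay f.
Proof. by move=> [_ /(_ 0)]. Qed.

Lemma rschwartz_is_derive f (x : R) : rschwartz f ->
  is_derive x 1 f (derive1 f x).
Proof. by move=> rf; apply: is_derive_derive1; exact: rschwartz_derivable. Qed.

Lemma decayM f g : decay f -> decay g -> decay (fun x => f x * g x).
Proof.
move=> df dg m; have [M fM] := df m; have [N gN] := dg 0%N.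
exists (M * N) => x; rewrite normrM mulrA; apply: ler_pM => //.
by have := gN x; rewrite expr0 mul1r.
Qed.

Lemma decayD f g : decay f -> decay g -> decay (fun x => f x + g x).
Proof.
move=> df dg m; have [M fM] := df m; have [N gN] := dg m.
exists (M + N) => x; apply: le_trans (lerD (fM x) (gN x)).
by rewrite -mulrDr ler_wpM2l ?exprn_ge0// ler_normD.
Qed.

Lemma decayZ c f : decay f -> decay (fun x => c * f x).
Proof.
move=> df m; have [M fM] := df m; exists (`|c| * M) => x.
by rewrite normrM mulrCA ler_wpM2l.
Qed.

(* Products of Schwartz functions are not stable under differentiation; their
   span is. *)
Inductive schwartz_alg : (R -> R) -> Prop :=
| schwartz_alg_in f : rschwartz f -> schwartz_alg f
| schwartz_algM f g : rschwartz f -> rschwartz g ->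
    schwartz_alg (fun x => f x * g x)
| schwartz_algD f g : schwartz_alg f -> schwartz_alg g ->
    schwartz_alg (fun x => f x + g x)
| schwartz_algZ c f : schwartz_alg f -> schwartz_alg (fun x => c * f x).

Lemma schwartz_alg_rschwartz f : schwartz_alg f -> rschwartz f.
Proof.
apply: rschwartz_coind => {}f; elim=> {f} [f rf|f g rf rg|f g _ [df ff af] _
  [dg fg ag]|c f _ [df ff af]].
- split; first by move=> x; exact: rschwartz_derivable.
    exact: rschwartz_decay.
  exact/schwartz_alg_in/rschwartz_derive1.
- have dfg x := is_derive_pM (rschwartz_is_derive x rf) (rschwartz_is_derive x
  rg).
  split.
  + by move=> x; exact: (@ex_derive _ _ _ _ _ _ _ (dfg x)).
  + exact: decayM (rschwartz_decay rf) (rschwartz_decay rg).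
  + rewrite (derive1_is_derive dfg); apply: schwartz_algD.
      exact: (schwartz_algM (rschwartz_derive1 rf) rg).
    exact: (schwartz_algM rf (rschwartz_derive1 rg)).
- have dfg x := is_derive_pD (is_derive_derive1 (df x)) (is_derive_derive1 (dg
  x)).
  split; last by rewrite (derive1_is_derive dfg); exact: schwartz_algD.
    by move=> x; exact: (@ex_derive _ _ _ _ _ _ _ (dfg x)).
  exact: decayD.
- have dcf x := is_derive_pZ c (is_derive_derive1 (df x)).
  split; last by rewrite (derive1_is_derive dcf); exact: schwartz_algZ.
    by move=> x; exact: (@ex_derive _ _ _ _ _ _ _ (dcf x)).
  exact: decayZ.
Qed.

Lemma rschwartzM f g : rschwartz f -> rschwartz g ->
  rschwartz (fun x => f x * g x).
Proof. by move=> *; apply: schwartz_alg_rschwartz; exact: schwartz_algM. Qed.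

Lemma rschwartzD f g : rschwartz f -> rschwartz g ->
  rschwartz (fun x => f x + g x).
Proof.
by move=> *; apply/schwartz_alg_rschwartz/schwartz_algD; exact: schwartz_alg_in.
Qed.

Lemma rschwartzZ c f : rschwartz f -> rschwartz (fun x => c * f x).
Proof.
by move=> *; apply/schwartz_alg_rschwartz/schwartz_algZ; exact: schwartz_alg_in.
Qed.

Lemma rschwartz_continuous f : rschwartz f -> continuous f.
Proof.
by move=> rf x; apply: differentiable_continuous;
  apply/derivable1_diffP/rschwartz_derivable.
Qed.

Lemma rschwartz_fast f : rschwartz f -> fast f.
Proof.
move=> rf; split; first exact: rschwartz_continuous.
have [M fM] := rschwartz_decay rf 0; have [N fN] := rschwartz_decay rf 2.
exists (M + N) => x; rewrite mulrDl mul1r; apply: lerD.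
  by have := fM x; rewrite expr0 mul1r.
by have := fN x; rewrite real_normK ?num_real.
Qed.

Lemma is_derive_gauss (c a x : R) :
  is_derive x 1 (fun x : R => expR (- (c * (x - a) ^+ 2)))
    (- (2 * c * (x - a)) * expR (- (c * (x - a) ^+ 2))).
Proof.
have d1 : is_derive x 1 (fun y : R => y - a) 1.
  rewrite -[X in is_derive _ _ _ X]addr0.
  exact: (is_derive_pD (is_derive_id _ _) (is_derive_cst _ _ _)).
have d2 := is_derive_pZ (- c) (is_derive_pM d1 d1).
have -> : (fun x : R => expR (- (c * (x - a) ^+ 2))) =
    expR \o (fun x : R => - c * ((x - a) * (x - a))).
  by apply/funext => y /=; rewrite mulNr expr2.
have -> : - (2 * c * (x - a)) * expR (- (c * (x - a) ^+ 2)) =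
    expR (- c * ((x - a) * (x - a))) * (- c * (1 * (x - a) + (x - a) * 1)).
  have -> : - (c * (x - a) ^+ 2) = - c * ((x - a) * (x - a)) by ring.
  by ring.
exact: is_derive1_comp.
Qed.

(** A single term of the exponential series is bounded by the whole sum. *)
Lemma exprn_le_expR n (x : R) : 0 <= x -> x ^+ n <= n`!%:R * expR x.
Proof.
case: n => [|n] x0.
  by rewrite expr0 fact0 mul1r (le_trans _ (expR_ge1Dx x))// lerDl.
rewrite mulrC -ler_pdivrMr ?ltr0n ?fact_gt0//.
by apply: le_trans (expR_ge1Dxn n x0); rewrite lerDr.
Qed.

Lemma decay_gauss (c a : R) : 0 < c ->
  decay (fun x => expR (- (c * (x - a) ^+ 2))).
Proof.
(* The power of |x| costs a factor exp |x|, and |x| is at most |x-a| + |a|. Completing the square at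
   |x-a| = 1/(2c) bounds |x-a| - c|x-a|^2 by 1/(4c). *)
move=> c0 m; exists (m`!%:R * expR (c^-1 / 4 + `|a|)) => x.
rewrite (ger0_norm (expR_ge0 _)).
apply: (@le_trans _ _ (m`!%:R * expR `|x| * expR (- (c * (x - a) ^+ 2)))).
  by rewrite ler_wpM2r ?expR_ge0// exprn_le_expR.
rewrite -mulrA ler_wpM2l// -expRD ler_expR.
have y2 : (x - a) ^+ 2 = `|x - a| ^+ 2 by rewrite real_normK ?num_real.
have xa : `|x| <= `|x - a| + `|a| by rewrite -{1}(subrK a x) ler_normD.
have := mulr_ge0 (ltW c0) (sqr_ge0 (`|x - a| - c^-1 / 2)).
have -> : c * (`|x - a| - c^-1 / 2) ^+ 2 =
    c * `|x - a| ^+ 2 - `|x - a| + c^-1 / 4.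
  by field; rewrite gt_eqF.
rewrite y2; lra.
Qed.

(** Induction in Horner form with [f] general: a factor x is handed over to [f], where it only
    raises the exponent in the decay bound by one. *)
Lemma decay_poly_mul (p : {poly R}) f : decay f -> decay (fun x => p.[x] * f x).
Proof.
elim/poly_ind: p f => [|p c IH] f df.
  have -> : (fun x => (0 : {poly R}).[x] * f x) = (fun x => 0 * f x).
    by apply/funext => x; rewrite horner0.
  exact: decayZ.
have -> : (fun x => (p * 'X + c%:P).[x] * f x) =
    (fun x => p.[x] * (x * f x) + c * f x).
  by apply/funext => x; rewrite hornerD hornerMX hornerC mulrDl mulrA.
apply: decayD; last exact: decayZ.
apply: IH => m; have [M fM] := df m.+1; exists M => x.
by rewrite normrM mulrA -exprSr.
Qed.

(** Polynomials times the Gaussian form a family stable under differentiation: [p] becomes p' -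
    2c(X-a)p. *)
Lemma rschwartz_gauss (c a : R) : 0 < c ->
  rschwartz (fun x => expR (- (c * (x - a) ^+ 2))).
Proof.
move=> c0; pose G (x : R) := expR (- (c * (x - a) ^+ 2)).
apply: (@rschwartz_coind (fun h => exists p : {poly R},
  h = fun x => p.[x] * G x)).
  move=> _ [p ->]; have dp x := is_derive_pM (is_derive_poly p x)
    (is_derive_gauss c a x).
  split.
  - by move=> x; exact: (@ex_derive _ _ _ _ _ _ _ (dp x)).
  - exact/decay_poly_mul/decay_gauss.
  - exists (p^`()%R - (2 * c)%:P * ('X - a%:P) * p).
    rewrite (derive1_is_derive dp); apply/funext => x.
    by rewrite hornerD hornerN !hornerM hornerXsubC hornerC /G; ring.
by exists 1; apply/funext => x; rewrite hornerC mul1r.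
Qed.

End RealSchwartz.

(** * The operator |D| on real Schwartz functions *)

Section AbsD.
Variable R : realType.
Implicit Types f g h : R -> R.

Lemma bcont_cosR : bcont (@cos R).
Proof. by apply: (bcont_ext _ (bcont_cos 1)) => x; rewrite mul1r. Qed.

Lemma bcont_sinR : bcont (@sin R).
Proof. by apply: (bcont_ext _ (bcont_sin 1)) => x; rewrite mul1r. Qed.

(** Integration by parts: the two integrands add up to the derivative of f(x) sin(lx). *)
Lemma trans_sin_derive1 f l : rschwartz f ->
  trans sin (derive1 f) l = - (l * trans cos f l).
Proof.
move=> rf; have ff := rschwartz_fast rf.
have ff' := rschwartz_fast (rschwartz_derive1 rf).
have fc := fastMr ff (bcont_cos l); have fs := fastMr ff' (bcont_sin l).
apply/eqP; rewrite -addr_eq0 /trans -rintZ// -rintD//; last exact: fastZ.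
apply/eqP; apply: (@rint_derive0 _ (fun x => f x * sin (l * x))).
- move=> x; rewrite mulrCA.
  exact: (is_derive_pM (rschwartz_is_derive x rf) (is_derive_sin_mul l x)).
- exact: fastMr ff (bcont_sin l).
- by apply: fastD => //; exact: fastZ.
Qed.

Lemma trans_cos_derive1 f l : rschwartz f ->
  trans cos (derive1 f) l = l * trans sin f l.
Proof.
move=> rf; have ff := rschwartz_fast rf.
have ff' := rschwartz_fast (rschwartz_derive1 rf).
have fs := fastMr ff (bcont_sin l); have fc := fastMr ff' (bcont_cos l).
apply/eqP; rewrite -subr_eq0 -mulNr /trans -rintZ// -rintD//; last exact: fastZ.
apply/eqP; apply: (@rint_derive0 _ (fun x => f x * cos (l * x))).
- move=> x; rewrite mulrCA.
  exact: (is_derive_pM (rschwartz_is_derive x rf) (is_derive_cos_mul l x)).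
- exact: fastMr ff (bcont_cos l).
- by apply: fastD => //; exact: fastZ.
Qed.

Definition abs_trans (k : R -> R) f l := `|l| * trans k f l.

(** Multiplying the weight 1 + l^2 by the symbol |l| leaves |l| and |l|^3, whence these two
    bounds. *)
Lemma fast_abs_trans k f : bcont (trans k f) ->
  (exists M, forall l, `|l * trans k f l| <= M) ->
  (exists M, forall l, `|l ^+ 3 * trans k f l| <= M) -> fast (abs_trans k f).
Proof.
move=> [ct _] [M fM] [N fN]; split.
  by move=> l; apply: cvgM; [exact: norm_continuous|exact: ct].
exists (M + N) => l; rewrite mulrDl mul1r; apply: lerD.
  by rewrite /abs_trans normrM normr_id -normrM.
apply: le_trans (fN l); rewrite /abs_trans [leRHS]normrM normrM normr_id normrX.
by rewrite mulrA -[l ^+ 2]real_normK ?num_real// -exprSr.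
Qed.

(** Each derivative of [f] trades cosine for sine and produces a factor l up to sign. So the bounds
    with l and l^3 come from the sine transforms of the first and third derivatives. *)
Lemma fast_abs_cos f : rschwartz f -> fast (abs_trans cos f).
Proof.
move=> rf; have rf' := rschwartz_derive1 rf; have rf'' := rschwartz_derive1 rf'.
have rf3 := rschwartz_derive1 rf''.
apply: fast_abs_trans.
- exact/bcont_trans/rschwartz_fast/rf/bcont_cosR.
- have [_ [M sM]] := bcont_trans bcont_sinR (rschwartz_fast rf').
  by exists M => l; apply: le_trans (sM l); rewrite trans_sin_derive1// normrN.
- have [_ [M sM]] := bcont_trans bcont_sinR (rschwartz_fast rf3).
  exists M => l; apply: le_trans (sM l).
  rewrite trans_sin_derive1// trans_cos_derive1// trans_sin_derive1//.
  by rewrite !mulrN opprK exprS expr2 -!mulrA.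
Qed.

Lemma fast_abs_sin f : rschwartz f -> fast (abs_trans sin f).
Proof.
move=> rf; have rf' := rschwartz_derive1 rf; have rf'' := rschwartz_derive1 rf'.
have rf3 := rschwartz_derive1 rf''.
apply: fast_abs_trans.
- exact/bcont_trans/rschwartz_fast/rf/bcont_sinR.
- have [_ [M sM]] := bcont_trans bcont_cosR (rschwartz_fast rf').
  by exists M => l; apply: le_trans (sM l); rewrite trans_cos_derive1.
- have [_ [M sM]] := bcont_trans bcont_cosR (rschwartz_fast rf3).
  exists M => l; apply: le_trans (sM l).
  rewrite trans_cos_derive1// trans_sin_derive1// trans_cos_derive1//.
  by rewrite mulrN normrN exprS expr2 -!mulrA.
Qed.

(** The real part of the inverse Fourier integral of |l| times the transform of [f], expanded into
    cosines and sines. *)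
Definition rabsD f x : R :=
  (2 * pi)^-1 * (trans cos (abs_trans cos f) x + trans sin (abs_trans sin f) x).

Lemma bcont_rabsD f : rschwartz f -> bcont (rabsD f).
Proof.
move=> rf; apply: bcontM; first exact: bcont_cst.
apply: bcontD; apply: bcont_trans.
- exact: bcont_cosR.
- exact: fast_abs_cos.
- exact: bcont_sinR.
- exact: fast_abs_sin.
Qed.

Lemma abs_transD k f g : bcont k -> fast f -> fast g ->
  abs_trans k (fun x => f x + g x) = (fun l => abs_trans k f l +
    abs_trans k g l).
Proof.
by move=> bk ff fg; apply/funext => l; rewrite /abs_trans transD// mulrDr.
Qed.

Lemma abs_transZ k c f : bcont k -> fast f ->
  abs_trans k (fun x => c * f x) = (fun l => c * abs_trans k f l).
Proof.
by move=> bk ff; apply/funext => l; rewrite /abs_trans transZ// mulrCA.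
Qed.

Lemma rabsD_add f g : rschwartz f -> rschwartz g ->
  rabsD (fun x => f x + g x) = (fun x => rabsD f x + rabsD g x).
Proof.
move=> rf rg; have [ff fg] := (rschwartz_fast rf, rschwartz_fast rg).
have [bc bs] := (bcont_cosR, bcont_sinR).
have [fcf fcg] := (fast_abs_cos rf, fast_abs_cos rg).
have [fsf fsg] := (fast_abs_sin rf, fast_abs_sin rg).
apply/funext => x; rewrite /rabsD !abs_transD// !transD// -mulrDr.
by rewrite addrACA.
Qed.

Lemma rabsD_scale c f : rschwartz f ->
  rabsD (fun x => c * f x) = (fun x => c * rabsD f x).
Proof.
move=> rf; have ff := rschwartz_fast rf.
have [bc bs] := (bcont_cosR, bcont_sinR).
have [fcf fsf] := (fast_abs_cos rf, fast_abs_sin rf).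
by apply/funext => x; rewrite /rabsD !abs_transZ// !transZ// -mulrDr mulrCA.
Qed.

(** A Plancherel formula: duality moves the outer transforms onto [g], and the result is visibly
    symmetric in [f] and [g]. *)
Lemma rint_mul_rabsD f g : rschwartz f -> rschwartz g ->
  rint (fun x => g x * rabsD f x) =
  (2 * pi)^-1 * (rint (fun l => `|l| * (trans cos f l * trans cos g l)) +
                 rint (fun l => `|l| * (trans sin f l * trans sin g l))).
Proof.
move=> rf rg; have [ff fg] := (rschwartz_fast rf, rschwartz_fast rg).
have [bc bs] := (bcont_cosR, bcont_sinR).
have [fcf fsf] := (fast_abs_cos rf, fast_abs_sin rf).
have fc : fast (fun x => g x * trans cos (abs_trans cos f) x).
  by apply: fastMr => //; exact: bcont_trans.
have fs : fast (fun x => g x * trans sin (abs_trans sin f) x).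
  by apply: fastMr => //; exact: bcont_trans.
transitivity (rint (fun x => (2 * pi)^-1 *
   (g x * trans cos (abs_trans cos f) x + g x * trans sin (abs_trans sin f)
     x))).
  by apply: rint_ext => x; rewrite /rabsD mulrCA; congr (_ * _); rewrite mulrDr.
rewrite rintZ ?rintD//; last exact: fastD.
move: (_^-1) => c; rewrite (trans_dual bc fcf fg) (trans_dual bs fsf fg).
rewrite /abs_trans; have E k : rint (fun l => `|l| * trans k f l * trans k g l)
  =
    rint (fun l => `|l| * (trans k f l * trans k g l)).
  by apply: rint_ext => l; rewrite mulrA.
by rewrite !E.
Qed.

Lemma rabsD_sym f g : rschwartz f -> rschwartz g ->
  rint (fun x => g x * rabsD f x) = rint (fun x => f x * rabsD g x).
Proof.
move=> rf rg; rewrite (rint_mul_rabsD rf rg) (rint_mul_rabsD rg rf).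
move: (_^-1) => c; have E k : rint (fun l => `|l| * (trans k f l * trans k g
  l)) =
    rint (fun l => `|l| * (trans k g l * trans k f l)).
  by apply: rint_ext => l; rewrite [trans k f l * _]mulrC.
by rewrite (E cos) (E sin).
Qed.

Lemma trans_cos_even f l : trans cos f (- l) = trans cos f l.
Proof. by apply: rint_ext => x; rewrite mulNr cosN. Qed.

Lemma trans_sin_odd f l : fast f -> trans sin f (- l) = - trans sin f l.
Proof.
move=> ff; rewrite /trans -rintN; last exact/fastMr/bcont_sin.
by apply: rint_ext => x; rewrite mulNr sinN mulrN.
Qed.

Local Open Scope complex_scope.

Lemma cintegral_real (f : R -> R) : cintegral (fun x => (f x)%:C) = (rint f)%:C.
Proof. by rewrite /cintegral /= rint0. Qed.

Lemma fourier_real f l : fast f ->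
  fourier (fun x => (f x)%:C) l = trans cos f l +i* (- trans sin f l).
Proof.
move=> ff; rewrite /fourier /cintegral /=; congr (_ +i* _).
  by apply: rint_ext => x; rewrite /= mul0r subr0 cosN.
rewrite /trans -rintN; last exact/fastMr/bcont_sin.
by apply: rint_ext => x; rewrite /= mul0r addr0 sinN mulrN.
Qed.

(** The imaginary part of the inverse Fourier integrand is odd in [l], because the cosine transform
    is even and the sine transform odd; it integrates to 0. *)
Lemma absD_real f x : rschwartz f -> absD (fun y => (f y)%:C) x =
  (rabsD f x)%:C.
Proof.
move=> rf; have ff := rschwartz_fast rf.
have [fcf fsf] := (fast_abs_cos rf, fast_abs_sin rf).
rewrite /absD /fourier_multiplier.
have -> : (fun l : R => (`|l|)%:C * fourier (fun y => (f y)%:C) l * expi (l *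
  x)) =
  (fun l : R => (abs_trans cos f l * cos (x * l) +
    abs_trans sin f l * sin (x * l)) +i*
     (abs_trans cos f l * sin (x * l) - abs_trans sin f l * cos (x * l))).
  apply/funext => l; rewrite fourier_real// /abs_trans /expi mulrC [l * x]mulrC.
  by apply/eqP; rewrite eq_complex /=; apply/andP; split; apply/eqP; ring.
rewrite /cintegral /= rintD; [|exact: fastMr fcf (bcont_cos x)|exact: fastMr
  fsf (bcont_sin x)].
have -> : rint (fun l => abs_trans cos f l * sin (x * l) - abs_trans sin f l *
  cos (x * l)) = 0.
  apply: rint_odd.
    by apply: fastB; [exact: fastMr fcf (bcont_sin x)|exact: fastMr fsf
      (bcont_cos x)].
  move=> l; rewrite /abs_trans trans_cos_even trans_sin_odd// normrN mulrN.
  by rewrite sinN cosN; ring.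
by rewrite -rmorphM.
Qed.

End AbsD.

(* Otherwise unification unfolds [rabsD] down to the integrals. *)
Opaque rabsD.

(** * Recovering a continuous function from its Gaussian averages *)

Section GaussianTest.
Variable R : realType.
Implicit Types h r : R -> R.

Lemma rintegrable_mul_bcont h g : rintegrable h -> bcont g ->
  rintegrable (fun x => h x * g x).
Proof.
move=> ih [cg [M gM]]; have iMh := integrableZl measurableT M ih.
apply: (le_integrable measurableT _ _ iMh).
  apply/measurable_EFinP; apply: measurable_funM.
    by apply/measurable_EFinP; case/integrableP: ih.
  exact: continuous_measurable_fun.
move=> x _ /=; rewrite lee_fin !normrM mulrC ler_wpM2r//.
by rewrite (le_trans (gM x))// ler_norm.
Qed.

(* For large [c] the mass of [h] near [a], of order [expR (- (c * d ^+ 2 / 4))],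
   beats the mass beyond distance [d], of order at most
   [expR (- (c * d ^+ 2))]. *)
Lemma gauss_localize_le0 h a : continuous h -> rintegrable h ->
  (forall c, 0 < c -> rint (fun x => h x * expR (- (c * (x - a) ^+ 2))) = 0) ->
  h a <= 0.
Proof.
move=> ch ih h0; rewrite leNgt; apply/negP => ha0.
pose e := h a / 2; have e0 : 0 < e by rewrite divr_gt0.
have /cvgrPdist_lt /(_ e e0) := ch a.
move=> /nbhs_ballP[d /= d0 near_a].
have he x : `|x - a| < d -> e < h x.
  move=> xd; have /near_a/= : ball a d x by rewrite /ball /= distrC.
  by move=> /ltr_distlBl; rewrite /e; lra.
pose N := rint (fun x => `|h x|).
have N0 : 0 <= N by apply: Rintegral_ge0.
(* [z] makes e d (1+z) = e d + N + 1 exceed [N], and [c] is chosen so that E1 = E2 exp(z).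
   Integrating the lower bound below would give e d exp(z) at most N, although exp(z) is at least
   1+z. *)
pose z := (N + 1) / (e * d); have ed0 : 0 < e * d by rewrite mulr_gt0.
have z0 : 0 < z by rewrite divr_gt0// ltr_wpDl.
pose c := z * (4 / 3) / d ^+ 2.
have c0 : 0 < c by rewrite /c divr_gt0 ?exprn_gt0// mulr_gt0// divr_gt0.
pose E1 := expR (- (c * (d / 2) ^+ 2)); pose E2 := expR (- (c * d ^+ 2)).
pose A : set R := `[a - d / 2, a + d / 2]%classic.
have ih' := integrable_norm ih.
(* Three zones: on [A] both [h] and the Gaussian are bounded below; elsewhere within distance [d] it
   suffices that [h] is positive; beyond [d] the Gaussian is at most [E2]. *)
have bound x : e * E1 * \1_A x - E2 * `|h x| <=
    h x * expR (- (c * (x - a) ^+ 2)).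
  have y2 : (x - a) ^+ 2 = `|x - a| ^+ 2 by rewrite real_normK ?num_real.
  have [xd|dx] := ltP `|x - a| d.
    have hx : 0 < h x by apply: lt_trans (he _ xd).
    apply: (@le_trans _ _ (e * E1 * \1_A x)).
      by rewrite gerBl mulr_ge0 ?expR_ge0.
    rewrite indicE; case: (boolP (x \in A)) => xA /=; last first.
      by rewrite mulr0 mulr_ge0 ?expR_ge0// ltW.
    rewrite mulr1 ler_pM ?expR_ge0 ?(ltW e0)// ?(ltW (he _ xd))//.
    rewrite ler_expR lerN2 ler_pM2l// y2 lerXn2r ?nnegrE ?divr_ge0 ?(ltW d0)//.
    move: xA; rewrite inE /A /= in_itv /= => /andP[? ?].
    by rewrite ler_norml; apply/andP; split; lra.
  rewrite indicE memNset ?mulr0 ?sub0r; last first.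
    rewrite /A /= in_itv /= => /andP[? ?]; move: dx; apply/negP; rewrite -ltNge.
    by rewrite ltr_norml; apply/andP; split; lra.
  apply: (@le_trans _ _ (- (expR (- (c * (x - a) ^+ 2)) * `|h x|))).
    rewrite lerN2 ler_wpM2r// ler_expR lerN2 ler_pM2l// y2.
    by rewrite lerXn2r ?nnegrE// ltW.
  by rewrite mulrC lerNl -mulNr ler_wpM2r ?expR_ge0// ler_normr lexx orbT.
have iA : rintegrable (\1_A : R -> R) by exact: integrable_indic_itv.
have mA : measurable A by exact: measurable_itv.
have rA : rint (\1_A : R -> R) = d.
  rewrite /Rintegral integral_indic//=.
  rewrite setIT lebesgue_measure_itv /= lte_fin.
  case: ifPn => [_|/negP[]]; last lra.
  by rewrite -EFinD /=; field.
have iA' : rintegrable (fun x => e * E1 * \1_A x).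
  exact: (integrableZl measurableT _ iA).
have ih2 : rintegrable (fun x => E2 * `|h x|).
  exact: (integrableZl measurableT _ ih').
have iG : rintegrable (fun x => h x * expR (- (c * (x - a) ^+ 2))).
  exact/rintegrable_mul_bcont/fast_bcont/rschwartz_fast/rschwartz_gauss.
have := le_Rintegral measurableT (integrableB measurableT iA' ih2) iG
  (fun x _ => bound x).
rewrite h0// RintegralB// !RintegralZl// -/N rA subr_le0.
have -> : E1 = E2 * expR z.
  by rewrite /E1 /E2 -expRD /c; congr expR; field; rewrite gt_eqF.
have E20 : 0 < E2 by exact: expR_gt0.
have -> : e * (E2 * expR z) * d = E2 * (e * d * expR z) by ring.
rewrite ler_pM2l// leNgt => /negP; apply.
apply: (@lt_le_trans _ _ (e * d * (1 + z))).
  rewrite mulrDr mulr1 /z [_ * (_ / _)]mulrC divfK ?gt_eqF//; lra.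
by rewrite ler_pM2l// expR_ge1Dx.
Qed.

Lemma gauss_localize h a : continuous h -> rintegrable h ->
  (forall c, 0 < c -> rint (fun x => h x * expR (- (c * (x - a) ^+ 2))) = 0) ->
  h a = 0.
Proof.
move=> ch ih h0; apply/eqP; rewrite eq_le gauss_localize_le0//=.
rewrite -oppr_le0; apply: (@gauss_localize_le0 (fun x => - h x)).
- by move=> x; apply: cvgN; exact: ch.
- have := rintegrable_mul_bcont ih (bcont_cst (-1)).
  by under eq_fun do rewrite mulrN1.
- move=> c c0; rewrite -[RHS](mulr0 (-1)) -(h0 c c0) -RintegralZl//.
    by apply: rint_ext => x; rewrite mulN1r mulNr.
  exact/rintegrable_mul_bcont/fast_bcont/rschwartz_fast/rschwartz_gauss.
Qed.

(** [r] need not be integrable, so localization is applied to [r] times the Gaussian of exponent 1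
    centred at the point. This keeps the value there, and a further Gaussian of exponent [c] merges
    with it into one of exponent c+1. *)
Lemma eq0_of_gauss_tests r : continuous r ->
  (forall w, rschwartz w -> rintegrable (fun x => r x * w x)) ->
  (forall w, rschwartz w -> rint (fun x => r x * w x) = 0) ->
  forall x, r x = 0.
Proof.
move=> cr ir r0 a; have rG c c0 := @rschwartz_gauss R c a c0.
have := @gauss_localize (fun x => r x * expR (- (1 * (x - a) ^+ 2))) a.
rewrite subrr expr0n mulr0 oppr0 expR0 mulr1; apply.
- move=> x; apply: cvgM; first exact: cr.
  by have := rschwartz_continuous (rG 1 ltr01); apply.
- by apply: ir; exact: rG.
- move=> c c0; rewrite -(r0 _ (rG _ (addr_gt0 c0 ltr01))).
  by apply: rint_ext => x; rewrite -mulrA -expRD -opprD -mulrDl [1 + c]addrC.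
Qed.

End GaussianTest.

(** In a product with nonconstant left factor, that factor must be [fast] and the right one a
    [bcont] hypothesis; densities and gradients are written in that order. *)
Ltac fast_tac :=
  lazymatch goal with
  | |- fast (fun x => @?f x - @?g x) => apply: (@fastB _ f g); fast_tac
  | |- fast (fun x => @?f x + @?g x) => apply: (@fastD _ f g); fast_tac
  | |- fast (fun x => @?f x * @?g x) =>
      lazymatch f with
      | fun=> ?c => apply: (@fastZ _ c g); fast_tac
      | _ => apply: (@fastMr _ f g); fast_tac
      end
  | |- _ => assumption
  end.

(** * Expansion of the energy along a line *)

Section FirstVariation.
Variable R : realType.

Lemma rschwartz_of_is_derive (f f' : R -> R) : rschwartz f ->
  (forall x : R, is_derive x (1 : R) f (f' x)) -> rschwartz f'.
Proof. by move=> rf /derive1_is_derive <-; exact: rschwartz_derive1. Qed.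

Lemma rschwartzB (f g : R -> R) : rschwartz f -> rschwartz g ->
  rschwartz (fun x => f x - g x).
Proof.
move=> rf /(rschwartzZ (-1)) rg; have := rschwartzD rf rg.
by under eq_fun do rewrite mulN1r.
Qed.

Variables h1 h2 h3 h4 h5 h6 h7 : R.

(** The arguments stand for |u|^2, the imaginary part of conj(u) u', |u'|^2, the imaginary part of
    conj(u) u''', and |D| |u|^2. *)
Definition density (r m k n A : R) : R :=
  h1 * r + h2 * m - h3 * k + h4 * (r * r) - h5 * n +
    h6 * (r * m) - h7 * (r * A).

Section Jet.
Variables r0 r1 r2 m0 m1 m2 k0 k1 k2 n0 n1 n2 A0 A1 A2 : R -> R.
Hypotheses (fr0 : fast r0) (fr1 : fast r1) (fr2 : fast r2).
Hypotheses (fm0 : fast m0) (fm1 : fast m1) (fm2 : fast m2).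
Hypotheses (fk0 : fast k0) (fk1 : fast k1) (fk2 : fast k2).
Hypotheses (fn0 : fast n0) (fn1 : fast n1) (fn2 : fast n2).
Hypotheses (bA0 : bcont A0) (bA1 : bcont A1) (bA2 : bcont A2).

(** Every argument of [density] is quadratic in u, hence of degree 2 in the step. Products of two
    arguments reach degree 4, and [L0] to [L4] collect the powers of [s]. *)
Let jet (f0 f1 f2 : R -> R) s x := f0 x + s * (f1 x + s * f2 x).

Let L0 x := density (r0 x) (m0 x) (k0 x) (n0 x) (A0 x).
Let L1 x := h1 * r1 x + h2 * m1 x - h3 * k1 x + h4 * (2 * (r0 x * r1 x))
  - h5 * n1 x + h6 * (r0 x * m1 x + r1 x * m0 x)
  - h7 * (r0 x * A1 x + r1 x * A0 x).
Let L2 x := h1 * r2 x + h2 * m2 x - h3 * k2 x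
  + h4 * (2 * (r0 x * r2 x) + r1 x * r1 x)
  - h5 * n2 x + h6 * (r0 x * m2 x + r1 x * m1 x + r2 x * m0 x)
  - h7 * (r0 x * A2 x + r1 x * A1 x + r2 x * A0 x).
Let L3 x := h4 * (2 * (r1 x * r2 x)) + h6 * (r1 x * m2 x + r2 x * m1 x)
  - h7 * (r1 x * A2 x + r2 x * A1 x).
Let L4 x := h4 * (r2 x * r2 x) + h6 * (r2 x * m2 x) - h7 * (r2 x * A2 x).

Let br0 : bcont r0. Proof. exact: fast_bcont. Qed.
Let br1 : bcont r1. Proof. exact: fast_bcont. Qed.
Let br2 : bcont r2. Proof. exact: fast_bcont. Qed.
Let bm0 : bcont m0. Proof. exact: fast_bcont. Qed.
Let bm1 : bcont m1. Proof. exact: fast_bcont. Qed.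
Let bm2 : bcont m2. Proof. exact: fast_bcont. Qed.
Let fL0 : fast L0. Proof. rewrite /L0 /density; fast_tac. Qed.
Let fL1 : fast L1. Proof. rewrite /L1; fast_tac. Qed.
Let fL2 : fast L2. Proof. rewrite /L2; fast_tac. Qed.
Let fL3 : fast L3. Proof. rewrite /L3; fast_tac. Qed.
Let fL4 : fast L4. Proof. rewrite /L4; fast_tac. Qed.

Lemma rint_density_jet s :
  rint (fun x => density (jet r0 r1 r2 s x) (jet m0 m1 m2 s x)
    (jet k0 k1 k2 s x) (jet n0 n1 n2 s x) (jet A0 A1 A2 s x)) =
  rint L0 + s * (rint L1 + s * (rint L2 + s * (rint L3 + s * rint L4))).
Proof.
have f4 := fastZ s fL4; have f34 := fastD fL3 f4; have f3 := fastZ s f34.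
have f24 := fastD fL2 f3; have f2 := fastZ s f24.
have f14 := fastD fL1 f2; have f1 := fastZ s f14.
rewrite -(rintZ s fL4) -(rintD fL3 f4) -(rintZ s f34) -(rintD fL2 f3).
rewrite -(rintZ s f24) -(rintD fL1 f2) -(rintZ s f14) -(rintD fL0 f1).
apply: rint_ext => x; rewrite /jet /density /L0 /L1 /L2 /L3 /L4 /density.
by ring.
Qed.

Lemma is_derive_rint_density : is_derive (0 : R) (1 : R)
  (fun s => rint (fun x => density (jet r0 r1 r2 s x) (jet m0 m1 m2 s x)
    (jet k0 k1 k2 s x) (jet n0 n1 n2 s x) (jet A0 A1 A2 s x))) (rint L1).
Proof.
have -> := funext rint_density_jet.
have did := is_derive_id (0 : R) (1 : R).
have d4 := is_derive_pM did (is_derive_cst (rint L4) (0 : R) (1 : R)).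
have d3 := is_derive_pM did (is_derive_pD (is_derive_cst (rint L3) (0 :
  R) (1 : R)) d4).
have d2 := is_derive_pM did (is_derive_pD (is_derive_cst (rint L2) (0 :
  R) (1 : R)) d3).
have d1 := is_derive_pM did (is_derive_pD (is_derive_cst (rint L1) (0 :
  R) (1 : R)) d2).
have := is_derive_pD (is_derive_cst (rint L0) (0 : R) (1 : R)) d1.
by rewrite /= !mul0r !addr0 add0r mul1r.
Qed.

End Jet.

End FirstVariation.

Ltac rschwartz_tac :=
  lazymatch goal with
  | |- rschwartz (fun x => @?f x - @?g x) => apply: (@rschwartzB _ f g);
    rschwartz_tac
  | |- rschwartz (fun x => @?f x + @?g x) => apply: (@rschwartzD _ f g);
    rschwartz_tac
  | |- rschwartz (fun x => @?f x * @?g x) =>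
      lazymatch f with
      | fun=> ?c => apply: (@rschwartzZ _ c g); rschwartz_tac
      | _ => apply: (@rschwartzM _ f g); rschwartz_tac
      end
  | |- _ => assumption
  end.

(** * Integration by parts: from the first variation to the gradient *)

Section Gradient.
Variable R : realType.
Variables h1 h2 h3 h4 h5 h6 h7 : R.
Variables a a1 a2 a3 b b1 b2 b3 c c1 c2 c3 d d1 d2 d3 : R -> R.
Hypotheses (ra : rschwartz a) (rb : rschwartz b).
Hypotheses (rc : rschwartz c) (rd : rschwartz d).
Hypothesis da : forall x : R, is_derive x (1 : R) a (a1 x).
Hypothesis da1 : forall x : R, is_derive x (1 : R) a1 (a2 x).
Hypothesis da2 : forall x : R, is_derive x (1 : R) a2 (a3 x).
Hypothesis db : forall x : R, is_derive x (1 : R) b (b1 x).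
Hypothesis db1 : forall x : R, is_derive x (1 : R) b1 (b2 x).
Hypothesis db2 : forall x : R, is_derive x (1 : R) b2 (b3 x).
Hypothesis dc : forall x : R, is_derive x (1 : R) c (c1 x).
Hypothesis dc1 : forall x : R, is_derive x (1 : R) c1 (c2 x).
Hypothesis dc2 : forall x : R, is_derive x (1 : R) c2 (c3 x).
Hypothesis dd : forall x : R, is_derive x (1 : R) d (d1 x).
Hypothesis dd1 : forall x : R, is_derive x (1 : R) d1 (d2 x).
Hypothesis dd2 : forall x : R, is_derive x (1 : R) d2 (d3 x).

Definition sqmod (a b : R -> R) x := a x * a x + b x * b x.
(** With u = a + ib and w = c + id, [polar] and [skew_polar] are the coefficients of [s] in [sqmod]
    and [skew] evaluated along u + s w. *)
Definition polar (a b c d : R -> R) x := 2 * (a x * c x + b x * d x).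

Definition skew (a a1 b b1 : R -> R) x := a x * b1 x - b x * a1 x.
Definition skew_polar (a a1 b b1 c c1 d d1 : R -> R) x :=
  c x * b1 x + a x * d1 x - (d x * a1 x + b x * c1 x).

(** [grad_re] and [grad_im] are the L^2 gradients in the real and imaginary parts of u. Terms with
    an odd number of derivatives pair each component with a derivative of the other one. *)
Definition grad_re (b1 a2 b3 a b : R -> R) x :=
  2 * h1 * a x + 2 * h2 * b1 x + 2 * h3 * a2 x + 4 * h4 * (sqmod a b x * a x)
  - 2 * h5 * b3 x + 4 * h6 * (sqmod a b x * b1 x)
  - 4 * h7 * (a x * rabsD (sqmod a b) x).
Definition grad_im (a1 b2 a3 a b : R -> R) x :=
  2 * h1 * b x - 2 * h2 * a1 x + 2 * h3 * b2 x + 4 * h4 * (sqmod a b x * b x)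
  + 2 * h5 * a3 x - 4 * h6 * (sqmod a b x * a1 x)
  - 4 * h7 * (b x * rabsD (sqmod a b) x).

Let ra1 := rschwartz_of_is_derive ra da.
Let ra2 := rschwartz_of_is_derive ra1 da1.
Let ra3 := rschwartz_of_is_derive ra2 da2.
Let rb1 := rschwartz_of_is_derive rb db.
Let rb2 := rschwartz_of_is_derive rb1 db1.
Let rb3 := rschwartz_of_is_derive rb2 db2.
Let rc1 := rschwartz_of_is_derive rc dc.
Let rc2 := rschwartz_of_is_derive rc1 dc1.
Let rc3 := rschwartz_of_is_derive rc2 dc2.
Let rd1 := rschwartz_of_is_derive rd dd.
Let rd2 := rschwartz_of_is_derive rd1 dd1.
Let rd3 := rschwartz_of_is_derive rd2 dd2.

Lemma rschwartz_bcont (f : R -> R) : rschwartz f -> bcont f.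
Proof. by move=> rf; exact/fast_bcont/rschwartz_fast. Qed.

Lemma rschwartz_sqmod (f g : R -> R) : rschwartz f -> rschwartz g ->
  rschwartz (sqmod f g).
Proof. by move=> rf rg; apply: rschwartzD; exact: rschwartzM. Qed.

Lemma rschwartz_skew (f f1 g g1 : R -> R) : rschwartz f -> rschwartz f1 ->
  rschwartz g -> rschwartz g1 -> rschwartz (skew f f1 g g1).
Proof. by move=> *; rewrite /skew; rschwartz_tac. Qed.

Lemma rschwartz_skew_polar (f f1 g g1 k k1 l l1 : R -> R) :
  rschwartz f -> rschwartz f1 -> rschwartz g -> rschwartz g1 ->
  rschwartz k -> rschwartz k1 -> rschwartz l -> rschwartz l1 ->
  rschwartz (skew_polar f f1 g g1 k k1 l l1).
Proof. by move=> *; rewrite /skew_polar; rschwartz_tac. Qed.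

Lemma rschwartz_polar : rschwartz (polar a b c d).
Proof. by apply/rschwartzZ/rschwartzD; exact: rschwartzM. Qed.

Lemma fast_grad_re : fast (grad_re b1 a2 b3 a b).
Proof.
have rho := rschwartz_sqmod ra rb; have bA := bcont_rabsD rho.
have frho := rschwartz_fast rho.
have [fa fb1 fa2 fb3] := And4 (rschwartz_fast ra) (rschwartz_fast rb1)
  (rschwartz_fast ra2) (rschwartz_fast rb3).
have [ba bb1] := (rschwartz_bcont ra, rschwartz_bcont rb1).
rewrite /grad_re; fast_tac.
Qed.

Lemma fast_grad_im : fast (grad_im a1 b2 a3 a b).
Proof.
have rho := rschwartz_sqmod ra rb; have bA := bcont_rabsD rho.
have frho := rschwartz_fast rho.
have [fb fa1 fb2 fa3] := And4 (rschwartz_fast rb) (rschwartz_fast ra1)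
  (rschwartz_fast rb2) (rschwartz_fast ra3).
have [bb ba1] := (rschwartz_bcont rb, rschwartz_bcont ra1).
rewrite /grad_im; fast_tac.
Qed.

(* The first variation differs from its gradient form by an exact derivative
   and by a term killed by the symmetry of [rabsD]. *)
Lemma rint_first_variation :
  rint (fun x => h1 * polar a b c d x
    + h2 * skew_polar a a1 b b1 c c1 d d1 x
    - h3 * polar a1 b1 c1 d1 x
    + h4 * (2 * (sqmod a b x * polar a b c d x))
    - h5 * skew_polar a a3 b b3 c c3 d d3 x
    + h6 * (sqmod a b x * skew_polar a a1 b b1 c c1 d d1 x
            + polar a b c d x * skew a a1 b b1 x)
    - h7 * (sqmod a b x * rabsD (polar a b c d) x
            + polar a b c d x * rabsD (sqmod a b) x)) =
  rint (fun x => grad_re b1 a2 b3 a b x * c x + grad_im a1 b2 a3 a b x * d x).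
Proof.
have rho := rschwartz_sqmod ra rb; have rpol := rschwartz_polar.
have bA0 := bcont_rabsD rho; have bA1 := bcont_rabsD rpol.
have sym := rabsD_sym rpol rho.
pose A0 := rabsD (sqmod a b); pose A1 := rabsD (polar a b c d).
have de x := is_derive_pD (is_derive_pM (da x) (dd x))
  (is_derive_pZ (-1) (is_derive_pM (db x) (dc x))).
have drho x := is_derive_pD (is_derive_pM (da x) (da x)) (is_derive_pM (db x)
  (db x)).
have dw x := is_derive_pD (is_derive_pM (da1 x) (dc x)) (is_derive_pM (db1 x)
  (dd x)).
have dadd x := is_derive_pD (is_derive_pD (is_derive_pM (da x) (dd2 x))
  (is_derive_pZ (-1) (is_derive_pM (da1 x) (dd1 x)))) (is_derive_pM (da2 x) (dd
    x)).
have dbcc x := is_derive_pD (is_derive_pD (is_derive_pM (db x) (dc2 x))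
  (is_derive_pZ (-1) (is_derive_pM (db1 x) (dc1 x)))) (is_derive_pM (db2 x) (dc
    x)).
(* The boundary terms: one integration by parts for [h2], [h3] and [h6], three for [h5], which
   yields the alternating sum a d'' - a' d' + a'' d and its analogue in b and c. The factors [-1]
   reproduce the shape delivered by [is_derive_pZ]. *)
pose F x := h2 * (a x * d x + -1 * (b x * c x))
  + - (2 * h3) * (a1 x * c x + b1 x * d x)
  + - h5 * (a x * d2 x + -1 * (a1 x * d1 x) + a2 x * d x
            + -1 * (b x * c2 x + -1 * (b1 x * c1 x) + b2 x * c x))
  + h6 * ((a x * a x + b x * b x) * (a x * d x + -1 * (b x * c x))).
have rF : rschwartz F by rewrite /F; rschwartz_tac.
have dF x := is_derive_pD (is_derive_pD (is_derive_pD
  (is_derive_pZ h2 (de x)) (is_derive_pZ (- (2 * h3)) (dw x)))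
  (is_derive_pZ (- h5) (is_derive_pD (dadd x) (is_derive_pZ (-1) (dbcc x)))))
  (is_derive_pZ h6 (is_derive_pM (drho x) (de x))).
have := rint_derive0 (F := F) dF (rschwartz_fast rF)
  (rschwartz_fast (rschwartz_of_is_derive (f := F) rF dF)).
set V := (V in rint V) => V0.
have fV : fast V by exact: (rschwartz_fast (rschwartz_of_is_derive (f :=
  F) rF dF)).
have frho := rschwartz_fast rho; have fpol := rschwartz_fast rpol.
pose G x := grad_re b1 a2 b3 a b x * c x + grad_im a1 b2 a3 a b x * d x.
have fG : fast G.
  rewrite /G; apply: fastD; apply: fastMr.
  - exact: fast_grad_re.
  - exact: rschwartz_bcont.
  - exact: fast_grad_im.
  - exact: rschwartz_bcont.
have fA : fast (fun x => sqmod a b x * A1 x) by exact: (fastMr frho bA1).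
have fB : fast (fun x => polar a b c d x * A0 x) by exact: (fastMr fpol bA0).
have fAB := fastZ (- h7) (fastB fA fB); have fVAB := fastD fV fAB.
(* Pointwise, the variation is the gradient form plus the derivative of [F] plus an antisymmetrized
   nonlocal term. *)
transitivity (rint (fun x => G x + (V x + - h7 *
    (sqmod a b x * A1 x - polar a b c d x * A0 x)))).
  apply: rint_ext => x; rewrite /G /V /grad_re /grad_im -/A0 -/A1 /sqmod /polar
    /skew
    /skew_polar.
  by ring.
rewrite (rintD fG fVAB) (rintD fV fAB) V0 (rintZ (- h7) (fastB fA fB)).
by rewrite (rintB fA fB) /A0 /A1 sym subrr mulr0 !addr0.
Qed.

End Gradient.

(** * From complex to real functions, and uniqueness of variational derivatives *)

Section ComplexReduction.
Variable R : realType.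
Local Open Scope complex_scope.
Implicit Types (u w f p q : R -> R[i]) (a b c d : R -> R).

Lemma derivable_ext a b (x : R) : (forall y, a y = b y) ->
  derivable a x (1 : R) -> derivable b x (1 : R).
Proof. by move=> /funext ->. Qed.

Lemma cderivenE n f x :
  cderiven n f x = derive1n n (fun y => Re (f y)) x +i* derive1n n (fun y => Im
    (f y)) x.
Proof.
suff E : cderiven n f = fun x => derive1n n (fun y => Re (f y)) x +i* derive1n
  n (fun y => Im (f y)) x.
  by rewrite E.
elim: n => [|n IH]; first by apply/funext => y; rewrite /=; case: (f y).
by rewrite /cderiven iterS -/(cderiven n f) IH /cderive !derive1nS.
Qed.

Lemma normc_ge_Im (z : R[i]) : `|Im z|%:C <= `|z|.
Proof.
by rewrite normc_def lecR -sqrtr_sqr ler_wsqrtr// lerDr sqr_ge0.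
Qed.

Lemma le_normc_ReIm (z : R[i]) : `|z| <= (`|Re z| + `|Im z|)%:C.
Proof.
rewrite normc_def lecR -[leRHS]ger0_norm ?addr_ge0// -sqrtr_sqr ler_wsqrtr//.
rewrite sqrrD !real_normK ?num_real// -addrA [_ *+ 2 + _]addrC addrA lerDl.
by rewrite mulrn_wge0// mulr_ge0.
Qed.

Lemma schwartz_Re f : schwartz f -> rschwartz (fun x => Re (f x)).
Proof.
move=> [df Mf]; split.
  move=> n x; have [+ _] := df n x.
  by apply: derivable_ext => y; rewrite cderivenE.
move=> n m; have [M fM] := Mf m n; exists M => x.
rewrite -lecR rmorphM; apply: le_trans (fM x); rewrite ler_wpM2l//.
  by rewrite lecR exprn_ge0.
by have := normc_ge_Re (cderiven n f x); rewrite cderivenE.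
Qed.

Lemma schwartz_Im f : schwartz f -> rschwartz (fun x => Im (f x)).
Proof.
move=> [df Mf]; split.
  move=> n x; have [_ +] := df n x.
  by apply: derivable_ext => y; rewrite cderivenE.
move=> n m; have [M fM] := Mf m n; exists M => x.
rewrite -lecR rmorphM; apply: le_trans (fM x); rewrite ler_wpM2l//.
  by rewrite lecR exprn_ge0.
by have := normc_ge_Im (cderiven n f x); rewrite cderivenE.
Qed.

Lemma schwartz_complex a b : rschwartz a -> rschwartz b ->
  schwartz (fun x => a x +i* b x).
Proof.
move=> [da Ma] [db Mb].
have E n x : cderiven n (fun x => a x +i* b x) x =
  derive1n n a x +i* derive1n n b x.
  by rewrite cderivenE.
split.
  move=> n x; split.
    by apply: derivable_ext (da n x) => y; rewrite E.
  by apply: derivable_ext (db n x) => y; rewrite E.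
move=> m n; have [M aM] := Ma n m; have [N bN] := Mb n m.
exists (M + N) => x; rewrite E.
apply: (@le_trans _ _ ((`|x| ^+ m)%:C * (`|derive1n n a x| +
  `|derive1n n b x|)%:C)).
  rewrite ler_wpM2l//; first by rewrite lecR exprn_ge0.
  exact: (le_normc_ReIm (_ +i* _)).
by rewrite -rmorphM lecR mulrDr lerD.
Qed.

Lemma real_cintegral (F : R -> R[i]) (h : R -> R) : (forall x,
  F x = (h x)%:C) ->
  cintegral F = (rint h)%:C.
Proof. by move=> /funext ->; exact: cintegral_real. Qed.

Lemma eq_of_gauss_tests (r s : R -> R) : continuous r -> continuous s ->
  (forall w : R -> R, rschwartz w -> [/\ rintegrable (fun x => r x * w x),
     rintegrable (fun x => s x * w x) &
     rint (fun x => r x * w x) = rint (fun x => s x * w x)]) ->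
  r =1 s.
Proof.
move=> cr cs H x; apply/eqP; rewrite -subr_eq0; apply/eqP.
apply: (@eq0_of_gauss_tests _ (fun x => r x - s x)).
- by move=> y; apply: cvgB; [exact: cr|exact: cs].
- move=> w /H[ir is_ _]; have := integrableB measurableT ir is_.
  by congr (_.-integrable _ _); apply/funext => y; rewrite /= mulrBl.
- move=> w /H[ir is_ e]; rewrite (rint_ext (g :=
  fun x => r x * w x - s x * w x)).
    by rewrite RintegralB// e subrr.
  by move=> y; rewrite mulrBl.
Qed.

(** A real variation w sees p + q, an imaginary one i w sees i(p - q). Real and imaginary parts give
    four real identities, which determine p and q. *)
Lemma variational_derivatives_unique (H : (R -> R[i]) -> R[i]) u p q p' q' :
  variational_derivatives H u p q -> variational_derivatives H u p' q' ->
  p =1 p' /\ q =1 q'.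
Proof.
move=> [[cp1 cp2] [cq1 cq2] Hw] [[cp1' cp2'] [cq1' cq2'] Hw'].
have Z (w : R -> R) : rschwartz w -> rschwartz (fun=> 0 : R).
  by move=> /(rschwartzZ 0); under eq_fun do rewrite mul0r.
have test_re (w : R -> R) : rschwartz w -> schwartz (fun x => w x +i* 0).
  by move=> rw; apply: schwartz_complex => //; exact: Z rw.
have test_im (w : R -> R) : rschwartz w -> schwartz (fun x => 0 +i* w x).
  by move=> rw; apply: (schwartz_complex (a := fun=> 0)) => //; exact: Z rw.
have cD (f f' : R -> R) : continuous f -> continuous f' ->
  continuous (fun x => f x + f' x).
  by move=> cf cf' x; apply: cvgD; [exact: cf|exact: cf'].
have cB (f f' : R -> R) : continuous f -> continuous f' ->
  continuous (fun x => f x - f' x).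
  by move=> cf cf' x; apply: cvgB; [exact: cf|exact: cf'].
(* Both pairings equal the same directional derivative of [H]. *)
have T (w : R -> R[i]) : schwartz w ->
    let D p q x := p x * w x + q x * (w x)^* in
    [/\ rintegrable (fun x => Re (D p q x)), rintegrable (fun x => Re (D p' q'
      x)) &
      rint (fun x => Re (D p q x)) = rint (fun x => Re (D p' q' x))] /\
    [/\ rintegrable (fun x => Im (D p q x)), rintegrable (fun x => Im (D p' q'
      x)) &
      rint (fun x => Im (D p q x)) = rint (fun x => Im (D p' q' x))].
  move=> sw D; have [_ [i1 i2] e] := Hw w sw; have [_ [i1' i2'] e'] := Hw' w sw.
  by move: (etrans (esym e) e'); rewrite /cintegral => -[eR eI].
have re_re (f f' : R -> R[i]) (w : R -> R) :
    (fun x => (Re (f x) + Re (f' x)) * w x) =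
    (fun x => Re (f x * (w x +i* 0) + f' x * (w x +i* 0)^*)).
  by apply/funext => x; case: (f x) (f' x) => [p1 p2] [q1 q2] /=; ring.
have re_im (f f' : R -> R[i]) (w : R -> R) :
    (fun x => (Im (f x) + Im (f' x)) * w x) =
    (fun x => Im (f x * (w x +i* 0) + f' x * (w x +i* 0)^*)).
  by apply/funext => x; case: (f x) (f' x) => [p1 p2] [q1 q2] /=; ring.
have im_re (f f' : R -> R[i]) (w : R -> R) :
    (fun x => (Im (f' x) - Im (f x)) * w x) =
    (fun x => Re (f x * (0 +i* w x) + f' x * (0 +i* w x)^*)).
  by apply/funext => x; case: (f x) (f' x) => [p1 p2] [q1 q2] /=; ring.
have im_im (f f' : R -> R[i]) (w : R -> R) :
    (fun x => (Re (f x) - Re (f' x)) * w x) =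
    (fun x => Im (f x * (0 +i* w x) + f' x * (0 +i* w x)^*)).
  by apply/funext => x; case: (f x) (f' x) => [p1 p2] [q1 q2] /=; ring.
have E1 : (fun x => Re (p x) + Re (q x)) =1 (fun x => Re (p' x) + Re (q' x)).
  apply: (eq_of_gauss_tests (cD _ _ cp1 cq1) (cD _ _ cp1' cq1')) => w rw.
  by rewrite !re_re; have [] := T _ (test_re _ rw).
have E2 : (fun x => Im (p x) + Im (q x)) =1 (fun x => Im (p' x) + Im (q' x)).
  apply: (eq_of_gauss_tests (cD _ _ cp2 cq2) (cD _ _ cp2' cq2')) => w rw.
  by rewrite !re_im; have [] := T _ (test_re _ rw).
have E3 : (fun x => Im (q x) - Im (p x)) =1 (fun x => Im (q' x) - Im (p' x)).
  apply: (eq_of_gauss_tests (cB _ _ cq2 cp2) (cB _ _ cq2' cp2')) => w rw.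
  by rewrite !im_re; have [] := T _ (test_im _ rw).
have E4 : (fun x => Re (p x) - Re (q x)) =1 (fun x => Re (p' x) - Re (q' x)).
  apply: (eq_of_gauss_tests (cB _ _ cp1 cq1) (cB _ _ cp1' cq1')) => w rw.
  by rewrite !im_im; have [] := T _ (test_im _ rw).
split=> x; move: (E1 x) (E2 x) (E3 x) (E4 x); case: (p x) (q x) => [p1 p2] [q1
  q2] /=;
  case: (p' x) (q' x) => [p1' p2'] [q1' q2'] /= e1 e2 e3 e4.
  by congr (_ +i* _); lra.
by congr (_ +i* _); lra.
Qed.

End ComplexReduction.

(** * Directional derivative of the energy in real coordinates *)

Section HamiltonianVariation.
Variable R : realType.
Local Open Scope complex_scope.

Lemma derive1n_lin n (a c : R -> R) s : rschwartz a -> rschwartz c ->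
  derive1n n (fun x => a x + s * c x) =
  (fun x => derive1n n a x + s * derive1n n c x).
Proof.
move=> ra rc; elim: n => // n IH; rewrite !derive1nS IH.
have ran := rschwartz_derive1n n ra; have rcn := rschwartz_derive1n n rc.
apply: derive1_is_derive => x.
exact: (is_derive_pD (rschwartz_is_derive x ran)
                     (is_derive_pZ s (rschwartz_is_derive x rcn))).
Qed.

Definition real_hamiltonian h1 h2 h3 h4 h5 h6 h7 (a b : R -> R) : R :=
  rint (fun x => density h1 h2 h3 h4 h5 h6 h7 (sqmod a b x)
    (skew a (derive1 a) b (derive1 b) x) (sqmod (derive1 a) (derive1 b) x)
    (skew a (derive1n 3 a) b (derive1n 3 b) x) (rabsD (sqmod a b) x)).

Variables h1 h2 h3 h4 h5 h6 h7 : R.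

Lemma real_hamiltonian_variation (a b c d : R -> R) :
  rschwartz a -> rschwartz b -> rschwartz c -> rschwartz d ->
  is_derive (0 : R) (1 : R)
    (fun s => real_hamiltonian h1 h2 h3 h4 h5 h6 h7
       (fun x => a x + s * c x) (fun x => b x + s * d x))
    (rint (fun x =>
      grad_re h1 h2 h3 h4 h5 h6 h7 (derive1 b) (derive1n 2 a) (derive1n 3 b) a
        b x * c x +
      grad_im h1 h2 h3 h4 h5 h6 h7 (derive1 a) (derive1n 2 b) (derive1n 3 a) a
        b x * d x)).
Proof.
move=> ra rb rc rd.
have D0 f (rf : rschwartz f) x : is_derive (x : R) (1 : R) f (derive1 f x).
  exact: rschwartz_is_derive.
have D1 f (rf : rschwartz f) x : is_derive (x : R) (1 :
  R) (derive1 f) (derive1n 2 f x).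
  by have rf' := rschwartz_derive1 rf; exact: (rschwartz_is_derive x rf').
have D2 f (rf : rschwartz f) x : is_derive (x : R) (1 :
  R) (derive1n 2 f) (derive1n 3 f x).
  by have rf' := rschwartz_derive1n 2 rf; exact: (rschwartz_is_derive x rf').
rewrite -(rint_first_variation h1 h2 h3 h4 h5 h6 h7 ra rb rc rd
  (D0 _ ra) (D1 _ ra) (D2 _ ra) (D0 _ rb) (D1 _ rb) (D2 _ rb)
  (D0 _ rc) (D1 _ rc) (D2 _ rc) (D0 _ rd) (D1 _ rd) (D2 _ rd)).
have [rr0 rr1 rr2] := And3 (rschwartz_sqmod ra rb) (rschwartz_polar ra rb rc rd)
  (rschwartz_sqmod rc rd).
have [ra1 rb1 rc1 rd1] := And4 (rschwartz_derive1 ra) (rschwartz_derive1 rb)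
  (rschwartz_derive1 rc) (rschwartz_derive1 rd).
have [ra3 rb3 rc3 rd3] := And4 (rschwartz_derive1n 3 ra) (rschwartz_derive1n 3
  rb)
  (rschwartz_derive1n 3 rc) (rschwartz_derive1n 3 rd).
have H := is_derive_rint_density h1 h2 h3 h4 h5 h6 h7
  (rschwartz_fast rr0) (rschwartz_fast rr1) (rschwartz_fast rr2)
  (rschwartz_fast (rschwartz_skew ra ra1 rb rb1))
  (rschwartz_fast (rschwartz_skew_polar ra ra1 rb rb1 rc rc1 rd rd1))
  (rschwartz_fast (rschwartz_skew rc rc1 rd rd1))
  (rschwartz_fast (rschwartz_sqmod ra1 rb1)) (rschwartz_fast (rschwartz_polar
    ra1 rb1 rc1 rd1))
  (rschwartz_fast (rschwartz_sqmod rc1 rd1))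
  (rschwartz_fast (rschwartz_skew ra ra3 rb rb3))
  (rschwartz_fast (rschwartz_skew_polar ra ra3 rb rb3 rc rc3 rd rd3))
  (rschwartz_fast (rschwartz_skew rc rc3 rd rd3))
  (bcont_rabsD rr0) (bcont_rabsD rr1) (bcont_rabsD rr2).
move: H; congr (is_derive _ _ _ _); apply/funext => s;
  rewrite /real_hamiltonian.
(* Along the line each argument of [density] takes the quadratic form assumed for jets; for the
   nonlocal one ([AE]) this is linearity of [rabsD]. *)
have sqE f g k l : sqmod (fun x => f x + s * k x) (fun x => g x + s * l x) =
    (fun x => sqmod f g x + s * (polar f g k l x + s * sqmod k l x)).
  by apply/funext => x; rewrite /sqmod /polar; ring.
have skE f f1 g g1 k k1 l l1 :
    skew (fun x => f x + s * k x) (fun x => f1 x + s * k1 x)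
         (fun x => g x + s * l x) (fun x => g1 x + s * l1 x) =
    (fun x => skew f f1 g g1 x +
       s * (skew_polar f f1 g g1 k k1 l l1 x + s * skew k k1 l l1 x)).
  by apply/funext => x; rewrite /skew /skew_polar; ring.
have rs2 := rschwartzZ s rr2; have r12 := rschwartzD rr1 rs2.
have rsr12 := rschwartzZ s r12.
have AE : rabsD (fun x => sqmod a b x + s * (polar a b c d x +
  s * sqmod c d x)) =
    (fun x => rabsD (sqmod a b) x +
      s * (rabsD (polar a b c d) x + s * rabsD (sqmod c d) x)).
  rewrite (rabsD_add rr0 rsr12) (rabsD_scale s r12).
  by rewrite (rabsD_add rr1 rs2) (rabsD_scale s rr2).
have [Ea Eb] := (derive1n_lin 1 s ra rc, derive1n_lin 1 s rb rd).
rewrite /= in Ea Eb; rewrite Ea Eb (derive1n_lin 3 s ra rc) (derive1n_lin 3 s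
  rb rd).
by rewrite !sqE !skE AE.
Qed.

End HamiltonianVariation.

(** * Return to complex notation and comparison with the Dysthe equation *)

Section Dysthe.
Variable R : realType.
Local Open Scope complex_scope.
Variables g gamma k0 eps : R.

Let w0 := omega0 g gamma k0.
Let W0 := Omega0 g gamma k0.
Let b0 := beta g gamma k0.
Let H1 := eps * W0.
Let H2 := eps ^+ 2 * (g / (2 * w0)).
Let H3 := eps ^+ 3 * (g ^+ 2 / (8 * w0 ^+ 3)).
Let H4 := eps ^+ 3 * (k0 ^+ 3 * (w0 - gamma) * (gamma ^+ 2 + 4 * w0 ^+ 2)
                   / (4 * w0 * W0 * (2 * w0 - gamma))).
Let H5 := eps ^+ 4 * (g ^+ 3 / (16 * w0 ^+ 5)).
Let H6 := eps ^+ 4 * (b0 / 2).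
Let H7 := eps ^+ 4 * (k0 ^+ 2 * w0 ^+ 2 / (2 * W0 ^+ 2)).

Lemma sqr_normc_ReIm (z : R[i]) : `|z| ^+ 2 = (Re z * Re z + Im z * Im z)%:C.
Proof. by rewrite -add_Re2_Im2 -!expr2. Qed.

Lemma Im_conj_mul (z z' : R[i]) : Im (z^* * z') = Re z * Im z' - Im z * Re z'.
Proof. by case: z z' => [a b] [a' b'] /=; ring. Qed.

Lemma density_complex h1 h2 h3 h4 h5 h6 h7 r m k n A :
  h1%:C * r%:C + h2%:C * m%:C - h3%:C * k%:C + h4%:C * (r%:C * r%:C)
  - h5%:C * n%:C + h6%:C * r%:C * m%:C - h7%:C * r%:C * A%:C =
  (density h1 h2 h3 h4 h5 h6 h7 r m k n A)%:C :> R[i].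
Proof.
by apply/eqP; rewrite eq_complex /density /=; apply/andP; split; apply/eqP;
  ring.
Qed.

Lemma hamiltonian_real u : schwartz u ->
  hamiltonian g gamma k0 eps u =
  (real_hamiltonian H1 H2 H3 H4 H5 H6 H7
     (fun x => Re (u x)) (fun x => Im (u x)))%:C.
Proof.
move=> su; have [ra rb] := (schwartz_Re su, schwartz_Im su).
have rr := rschwartz_sqmod ra rb.
rewrite /hamiltonian; apply: real_cintegral => x.
rewrite -/w0 -/W0 -/b0 -/H1 -/H2 -/H3 -/H4 -/H5 -/H6 -/H7.
rewrite (_ : absD _ x = (rabsD (sqmod (fun x => Re (u x)) (fun x => Im (u x)))
  x)%:C);
  last first.
  rewrite -(absD_real x rr); congr (absD _ x).
  by apply/funext => y; exact: sqr_normc_ReIm.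
have -> : `|u x| ^+ 4 = (`|u x| ^+ 2) * (`|u x| ^+ 2) by rewrite -exprD.
rewrite !Im_conj_mul !sqr_normc_ReIm cderivenE.
exact: density_complex.
Qed.

(* d/d(u^* ) = (d/d(Re u) + i d/d(Im u)) / 2 *)
Definition grad_conj u x : R[i] :=
  let a y := Re (u y) in let b y := Im (u y) in
  (grad_re H1 H2 H3 H4 H5 H6 H7 (derive1 b) (derive1n 2 a) (derive1n 3 b) a b x
    / 2) +i*
  (grad_im H1 H2 H3 H4 H5 H6 H7 (derive1 a) (derive1n 2 b) (derive1n 3 a) a b x
    / 2).

(** With q = (P + iQ)/2 and p its conjugate, p w + q conj(w) is twice the real part of q conj(w),
    that is P c + Q d. *)
Lemma hamiltonian_variational_derivatives u : schwartz u ->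
  variational_derivatives (hamiltonian g gamma k0 eps) u
    (fun x => (grad_conj u x)^*) (grad_conj u).
Proof.
move=> su; have [ra rb] := (schwartz_Re su, schwartz_Im su).
set a := fun x => Re (u x) in ra; set b := fun x => Im (u x) in rb.
pose P := grad_re H1 H2 H3 H4 H5 H6 H7 (derive1 b) (derive1n 2 a) (derive1n 3
  b) a b.
pose Q := grad_im H1 H2 H3 H4 H5 H6 H7 (derive1 a) (derive1n 2 b) (derive1n 3
  a) a b.
have fP : fast P.
  exact: (fast_grad_re H1 H2 H3 H4 H5 H6 H7 ra rb (fun x => rschwartz_is_derive
    x ra)
    (fun x => rschwartz_is_derive x (rschwartz_derive1 ra))
    (fun x => rschwartz_is_derive x rb)
    (fun x => rschwartz_is_derive x (rschwartz_derive1 rb))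
    (fun x => rschwartz_is_derive x (rschwartz_derive1n 2 rb))).
have fQ : fast Q.
  exact: (fast_grad_im H1 H2 H3 H4 H5 H6 H7 ra rb (fun x => rschwartz_is_derive
    x ra)
    (fun x => rschwartz_is_derive x (rschwartz_derive1 ra))
    (fun x => rschwartz_is_derive x (rschwartz_derive1n 2 ra))
    (fun x => rschwartz_is_derive x rb)
    (fun x => rschwartz_is_derive x (rschwartz_derive1 rb))).
have cP2 : continuous (fun x => P x / 2).
  by have [] := fastMr fP (bcont_cst 2^-1).
have cQ2 : continuous (fun x => Q x / 2).
  by have [] := fastMr fQ (bcont_cst 2^-1).
have cQ2' : continuous (fun x => - (Q x / 2)).
  by have [] := fastN (fastMr fQ (bcont_cst 2^-1)).
split=> // w sw; have [rc rd] := (schwartz_Re sw, schwartz_Im sw).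
set c := fun x => Re (w x) in rc; set d := fun x => Im (w x) in rd.
move=> Hw dH; pose J s := real_hamiltonian H1 H2 H3 H4 H5 H6 H7
  (fun x => a x + s * c x) (fun x => b x + s * d x).
have HwE : Hw = fun s => (J s)%:C.
  apply/funext => s; rewrite /Hw.
  have -> : (fun X => u X + s%:C * w X) = (fun x => (a x +
    s * c x) +i* (b x + s * d x)).
    apply/funext => x; rewrite /a /b /c /d; case: (u x) (w x) => [? ?] [? ?].
    by apply/eqP; rewrite eq_complex /= !mul0r subr0 addr0 !eqxx.
  by rewrite hamiltonian_real//; apply: schwartz_complex;
    apply: rschwartzD => //;
    exact: rschwartzZ.
have dJ := real_hamiltonian_variation H1 H2 H3 H4 H5 H6 H7 ra rb rc rd.
have dHE x : dH x = (P x * c x + Q x * d x)%:C.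
  rewrite /dH /grad_conj -/P -/Q /c /d; case: (w x) => [? ?] /=.
  by apply/eqP; rewrite eq_complex /=; apply/andP; split; apply/eqP; field.
have fdH : fast (fun x => P x * c x + Q x * d x).
  by apply: fastD; apply: fastMr => //; exact: rschwartz_bcont.
have -> : Hw = _ := HwE.
split.
- by split=> /=; [exact: ex_derive|exact: derivable_cst].
- have -> : dH = _ := funext dHE.
  by split; [exact: integrable_fast|exact: integrable0].
- rewrite (real_cintegral dHE) /cderive /= derive1_cst.
  by rewrite derive1E (derive_val (is_derive := dJ)).
Qed.

(** The powers of [eps] are split off from the coefficients, and the doublings of [c4], [c7] and of
    [c6 / 2] are made explicit; the values at a point are free variables, so this is field
    arithmetic. *)
Lemma dysthe_rhs_algebra c2 c3 c4 c5 c6 c7 (a b a1 b1 a2 b2 a3 b3 r A : R) :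
  eps != 0 ->
  W0%:C * (a +i* b) - 'i%C * (eps * c2)%:C * (a1 +i* b1)
  + (eps ^+ 2 * c3)%:C * (a2 +i* b2)
  + (eps ^+ 2 * (2 * c4))%:C * r%:C * (a +i* b)
  + 'i%C * (eps ^+ 3 * c5)%:C * (a3 +i* b3)
  - 'i%C * (eps ^+ 3 * c6)%:C * r%:C * (a1 +i* b1)
  - (eps ^+ 3 * (2 * c7))%:C * (a +i* b) * A%:C =
  (eps^-1)%:C *
   (((2 * (eps * W0) * a + 2 * (eps ^+ 2 * c2) * b1 + 2 * (eps ^+ 3 * c3) * a2
     + 4 * (eps ^+ 3 * c4) * (r * a) - 2 * (eps ^+ 4 * c5) * b3
     + 4 * (eps ^+ 4 * (c6 / 2)) * (r * b1) - 4 * (eps ^+ 4 * c7) * (a * A)) /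
       2) +i*
    ((2 * (eps * W0) * b - 2 * (eps ^+ 2 * c2) * a1 + 2 * (eps ^+ 3 * c3) * b2
     + 4 * (eps ^+ 3 * c4) * (r * b) + 2 * (eps ^+ 4 * c5) * a3
     - 4 * (eps ^+ 4 * (c6 / 2)) * (r * a1) - 4 * (eps ^+ 4 * c7) * (b * A)) /
       2)).
Proof.
move: W0 => W e0; apply/eqP; rewrite eq_complex /=.
by apply/andP; split; apply/eqP; field.
Qed.

Lemma dysthe_equationE (u : R -> R -> R[i]) t : 0 < eps ->
  schwartz (fun x => u x t) ->
  dysthe_equation g gamma k0 eps u t <->
  forall x, 'i%R * cderive (fun s => u x s) t =
    (eps^-1)%:C * grad_conj (fun x => u x t) x.
Proof.
move=> eps0 su; have [ra rb] := (schwartz_Re su, schwartz_Im su).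
have rr := rschwartz_sqmod ra rb.
have iffE (X Y Z : R -> R[i]) : (forall x, Y x = Z x) ->
  (forall x, X x = Y x) <-> (forall x, X x = Z x).
  by move=> YZ; split=> h x; rewrite h YZ.
apply: iffE => x.
rewrite -/w0 -/W0 -/b0 (_ : absD _ x =
  (rabsD (sqmod (fun x => Re (u x t)) (fun x => Im (u x t))) x)%:C); last first.
  rewrite -(absD_real x rr); congr (absD _ x).
  by apply/funext => y; exact: sqr_normc_ReIm.
(* With the convention that 0 has inverse 0, this also covers a vanishing [Y]. *)
have two_half (X Y : R) : X / Y = 2 * (X / (2 * Y)).
  by rewrite invfM mulrCA [2 * (_ * _)]mulrA divff ?mul1r.
have -> : k0 ^+ 3 * (w0 - gamma) * (gamma ^+ 2 + 4 * w0 ^+ 2)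
    / (2 * w0 * W0 * (2 * w0 - gamma)) =
  2 * (k0 ^+ 3 * (w0 - gamma) * (gamma ^+ 2 + 4 * w0 ^+ 2)
    / (4 * w0 * W0 * (2 * w0 - gamma))).
  by rewrite two_half !mulrA -natrM.
rewrite (two_half _ (W0 ^+ 2)) !cderivenE sqr_normc_ReIm -complexiE.
have vE : Re (u x t) +i* Im (u x t) = u x t by case: (u x t).
set a := fun x => Re (u x t); set b := fun x => Im (u x t).
have := dysthe_rhs_algebra (g / (2 * w0)) (g ^+ 2 / (8 * w0 ^+ 3))
  (k0 ^+ 3 * (w0 - gamma) * (gamma ^+ 2 + 4 * w0 ^+ 2)
    / (4 * w0 * W0 * (2 * w0 - gamma)))
  (g ^+ 3 / (16 * w0 ^+ 5)) b0 (k0 ^+ 2 * w0 ^+ 2 / (2 * W0 ^+ 2))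
  (a x) (b x) (derive1 a x) (derive1 b x) (derive1n 2 a x) (derive1n 2 b x)
  (derive1n 3 a x) (derive1n 3 b x) (sqmod a b x) (rabsD (sqmod a b) x)
  (lt0r_neq0 eps0).
by rewrite {1 2 3}/a {1 2 3}/b vE => H; exact: H.
Qed.

End Dysthe.

Local Open Scope complex_scope.

Theorem mainTheorem4 (R : realType) (g gamma k0 eps : R)
  (hg : 0 < g) (hk0 : 0 < k0) (heps : 0 < eps)
  (u : R -> R -> R[i]) (t : R)
  (hu : schwartz (fun X => u X t))
  (hut : forall X : R, cderivable (fun s => u X s) t) :
  hamiltonian_system eps (hamiltonian g gamma k0 eps) u t <->
  dysthe_equation g gamma k0 eps u t.
Proof.
have eps0 := heps; have -> := dysthe_equationE g gamma k0 heps hu.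
set v := fun x => u x t.
have vd := hamiltonian_variational_derivatives g gamma k0 eps hu.
(* Multiplication by i turns the first row of the system into the form of the Dysthe equation. *)
have solve (z q : R[i]) : (z = (eps^-1)%:C * (- 'i%C * q)) <-> ('i%C * z =
  (eps^-1)%:C * q).
  have iz (y : R[i]) : y = - 'i%C * ('i%C * y).
    by case: y => ? ?; apply/eqP; rewrite eq_complex /=; apply/andP; split;
      apply/eqP; ring.
  split=> [->|e]; last by rewrite (iz z) e; case: q e => ? ? _;
    apply/eqP; rewrite eq_complex /=; apply/andP; split; apply/eqP; ring.
  by case: q => ? ?; apply/eqP; rewrite eq_complex /=; apply/andP; split;
    apply/eqP; ring.
rewrite -!complexiE in solve *; split.
  (* The system only provides some pair of variational derivatives; uniqueness identifies its [q]
     with [grad_conj]. *)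
  move=> [p [q [vdpq E]]] x; have [_ qE] := variational_derivatives_unique vdpq
    vd.
  by have [/solve] := E x; rewrite qE.
move=> E; exists (fun x => (grad_conj g gamma k0 eps v x)^*),
  (grad_conj g gamma k0 eps v).
split=> // x; have /solve e := E x; split=> //.
(* The second row is the conjugate of the first once conjugation commutes with the time derivative;
   differentiability in time of the imaginary part enters here. *)
have -> : cderive (fun s => (u x s)^*) t = (cderive (fun s => u x s) t)^*.
  have [_ dI] := hut x; rewrite /cderive /=; congr (_ +i* _).
    by congr (derive1 _ t); apply/funext => s; case: (u x s).
  rewrite !derive1E -deriveN//; congr (derive _ t 1).
  by apply/funext => s; rewrite fctE; case: (u x s).
rewrite e -complexiE; move: (grad_conj _ _ _ _ _ _) (eps^-1) => [q1 q2] c.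
by apply/eqP; rewrite eq_complex /=; apply/andP; split; apply/eqP; ring.
Qed.
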